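(* Let $p\in\,]1,2[$, $m>0$, $g\in\mathbb{R}$, $\mathbf{e}_3=(0,0,1)^\top$. Consider the translational dynamics $\dot b=v$, $m\dot v=mg\mathbf{e}_3-fR\mathbf{e}_3+\varphi_D$ ($b,v\in\mathbb{R}^3$, $f\in\mathbb{R}$, $R\in SO(3)$, disturbance $\varphi_D\in\mathbb{R}^3$), a desired trajectory $b^d(t)$ with $v^d=\dot b^d$, and tracking errors $\tilde b=b-b^d$, $\tilde v=v-v^d$, so that $\dot{\tilde b}=\tilde v$, $m\dot{\tilde v}=mg\mathbf{e}_3-fR\mathbf{e}_3+\varphi_D-m\dot v^d$. Let $H(x,k)=I-\frac{2k}{x^\top x}xx^\top$ and $$\phi_1(z)=k_{t3}z+(z^\top z)^{\frac{1-p}{3p-2}}z,\quad \phi_2(z)=k_{t3}^2z+\frac{2k_{t3}(2p-1)}{3p-2}(z^\top z)^{\frac{1-p}{3p-2}}z+\frac{p}{3p-2}(z^\top z)^{\frac{2(1-p)}{3p-2}}z.$$ Let $\hat\varphi_D$ be produced by the observer with states $(\hat b,\hat v,\hat\varphi_D)$, errors $e_b=b-\hat b$, $e_v=v-\hat v$, $e_\varphi=\varphi_D-\hat\varphi_D$, $\psi_t=e_v+\kappa_t[e_b+(e_b^\top e_b)^{\frac{1-p}{p}}e_b]$: $$\dot{\hat b}=\hat v,\quad m\dot{\hat v}=mg\mathbf{e}_3-fR\mathbf{e}_3+mk_{t1}\phi_1(\psi_t)+m\kappa_t\Big[(e_b^\top e_b)^{\frac{1-p}{p}}H\Big(e_b,\tfrac{p-1}{p}\Big)e_v+e_v\Big]+\hat\varphi_D,\quad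 \dot{\hat\varphi}_D=mk_{t2}\phi_2(\psi_t),$$ with positive gains $k_{t1},k_{t2},k_{t3},\kappa_t$ such that $\mathcal{A}_t=\begin{bmatrix}-k_{t1}&1\\-k_{t2}&0\end{bmatrix}$ is Hurwitz, $\kappa_t>1/2$, and for some symmetric positive definite $\mathcal{Q}_t\in\mathbb{R}^{2\times2}$ the unique solution $\mathcal{P}_t$ of $\mathcal{A}_t^\top\mathcal{P}_t+\mathcal{P}_t\mathcal{A}_t=-\mathcal{Q}_t$ satisfies $k_{t3}\frac{\lambda_{\min}\{\mathcal{Q}_t\}}{\lambda_{\max}\{\mathcal{P}_t\}}-\frac{1}{k_{t3}^2\lambda_{\min}\{\mathcal{P}_t\}}>0$. Let $$\Gamma_{t1}=\min\Big\{k_{t3}\frac{\lambda_{\min}\{\mathcal{Q}_t\}}{\lambda_{\max}\{\mathcal{P}_t\}}-\frac{1}{k_{t3}^2\lambda_{\min}\{\mathcal{P}_t\}},\ 2\kappa_t-1\Big\}.$$ Apply the control force $$fR\mathbf{e}_3=mg\mathbf{e}_3+k_{TD}L_T\big[\psi_T+(\psi_T^\top\psi_T)^{\frac{1-p}{p}}\psi_T\big]+k_{TP}L_T\tilde b+m\kappa_T\Big[\tilde v+(\tilde b^\top\tilde b)^{\frac{1-p}{p}}H\Big(\tilde b,\tfrac{p-1}{p}\Big)\tilde v\Big]-m\dot v^d+\hat\varphi_D,$$ where $\psi_T=\tilde v+\kappa_T[\tilde b+(\tilde b^\top\tilde b)^{\frac{1-p}{p}}\tilde b]$, with positive scalars $\kappa_T,k_{TD},k_{TP}$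 and positive definite diagonal $L_T=\mathrm{diag}(L_{T1},L_{T2},L_{T3})$ satisfying $k_{TD}\lambda_{\min}\{L_T\}-\frac12>0$ and $\Gamma_{t1}-\frac{m^2}{2\lambda_{\min}\{\mathcal{P}_t\}}>0$. Then the tracking errors satisfy $$\dot{\tilde b}=\tilde v,\quad m\dot{\tilde v}=e_\varphi-k_{TD}L_T\big[\psi_T+(\psi_T^\top\psi_T)^{\frac{1-p}{p}}\psi_T\big]-k_{TP}L_T\tilde b-m\kappa_T\Big[\tilde v+(\tilde b^\top\tilde b)^{\frac{1-p}{p}}H\Big(\tilde b,\tfrac{p-1}{p}\Big)\tilde v\Big],$$ and, when the disturbance force is constant ($\dot\varphi_D=0$), this tracking error dynamics combined with the observer error dynamics is fast finite-time stable at $(\tilde b,\tilde v,e_b,e_v,e_\varphi)=(0,0,0,0,0)$.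
   Context: $\lambda_{\min},\lambda_{\max}$ denote minimum and maximum eigenvalues. An equilibrium is fast finite-time stable (FFTS) if it is Lyapunov stable and solutions reach it in finite time, with convergence governed by a positive definite function $V$ satisfying $\dot V\le-\lambda_1V-\lambda_2V^\alpha$ ($\lambda_1,\lambda_2>0$, $\alpha\in]0,1[$), giving settling time $T\le\frac{1}{\lambda_1(1-\alpha)}\ln\frac{\lambda_1V^{1-\alpha}(x_0)+\lambda_2}{\lambda_2}$. The observer error dynamics is $\dot e_b=e_v$, $m\dot e_v=-mk_{t1}\phi_1(\psi_t)-m\kappa_t[(e_b^\top e_b)^{\frac{1-p}{p}}H(e_b,\frac{p-1}{p})e_v+e_v]+e_\varphi$, $\dot e_\varphi=-mk_{t2}\phi_2(\psi_t)+\dot\varphi_D$. The thrust vector $fR\mathbf{e}_3$ is assumed to be realized exactly as commanded. *)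

(* Defs.v *)
From HB Require Import structures.
From mathcomp Require Import all_boot all_order all_algebra.
From mathcomp Require Import all_classical all_reals all_analysis.
From mathcomp Require Import complex.
Set Implicit Arguments.
Unset Strict Implicit.
Unset Printing Implicit Defensive.
Import Order.TTheory GRing.Theory Num.Theory.
Import numFieldNormedType.Exports.
Local Open Scope ring_scope.

Section Defs.
Variable R : realType.

Definition dotv (x y : 'cV[R]_3) : R := (x^T *m y) 0 0.

Definition e3 : 'cV[R]_3 := \col_i (if val i == 2%N then 1 else 0).

Definition Hmat (x : 'cV[R]_3) (k : R) : 'M[R]_3 :=
  1%:M - ((2 * k) / dotv x x) *: (x *m x^T).

(* (x^T x)^a x, with the real power powR (so 0 `^ a = 0 for a <> 0). *)
Definition spow (x : 'cV[R]_3) (a : R) : 'cV[R]_3 := ((dotv x x) `^ a) *: x.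

Definition phi1 (p kt3 : R) (z : 'cV[R]_3) : 'cV[R]_3 :=
  kt3 *: z + spow z ((1 - p) / (3 * p - 2)).

Definition phi2 (p kt3 : R) (z : 'cV[R]_3) : 'cV[R]_3 :=
  kt3 ^+ 2 *: z
  + ((2 * kt3 * (2 * p - 1)) / (3 * p - 2)) *: spow z ((1 - p) / (3 * p - 2))
  + (p / (3 * p - 2)) *: spow z ((2 * (1 - p)) / (3 * p - 2)).

Definition satv (p : R) (x : 'cV[R]_3) : 'cV[R]_3 := x + spow x ((1 - p) / p).

Definition dsatv (p : R) (x y : 'cV[R]_3) : 'cV[R]_3 :=
  y + ((dotv x x) `^ ((1 - p) / p)) *: (Hmat x ((p - 1) / p) *m y).

Definition psiv (p kappa : R) (x y : 'cV[R]_3) : 'cV[R]_3 :=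
  y + kappa *: satv p x.

(* Control force f R e3 (thrust vector), as a function of the tracking
   errors bt = b - b^d, vt = v - v^d, of ad = dv^d/dt and of hat phi_D. *)
Definition control (p m g kT kTD kTP : R) (LT : 'M[R]_3)
  (bt vt ad phihat : 'cV[R]_3) : 'cV[R]_3 :=
  (m * g) *: e3
  + kTD *: (LT *m satv p (psiv p kT bt vt))
  + kTP *: (LT *m bt)
  + (m * kT) *: dsatv p bt vt
  - m *: ad + phihat.

(* Right-hand side of  m d(vt)/dt  in the closed tracking loop. *)
Definition track_rhs (p m kT kTD kTP : R) (LT : 'M[R]_3)
  (bt vt ephi : 'cV[R]_3) : 'cV[R]_3 :=
  ephi
  - kTD *: (LT *m satv p (psiv p kT bt vt))
  - kTP *: (LT *m bt)
  - (m * kT) *: dsatv p bt vt.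

(* Right-hand side of  m d(e_v)/dt  in the observer error dynamics. *)
Definition obs_rhs (p m kt1 kt3 kappat : R) (eb ev ephi : 'cV[R]_3)
  : 'cV[R]_3 :=
  - (m * kt1) *: phi1 p kt3 (psiv p kappat eb ev)
  - (m * kappat) *: dsatv p eb ev
  + ephi.

(* Closed-loop state X in R^{3x5}: columns (bt, vt, e_b, e_v, e_phi). *)
Definition xc (k : nat) (X : 'M[R]_(3, 5)) : 'cV[R]_3 := col (inord k) X.

(* Vector field of tracking error dynamics + observer error dynamics,
   with a constant disturbance (d phi_D / dt = 0). *)
Definition closed_loop (p m kt1 kt2 kt3 kappat kT kTD kTP : R) (LT : 'M[R]_3)
  (X : 'M[R]_(3, 5)) : 'M[R]_(3, 5) :=
  let bt := xc 0 X in let vt := xc 1 X in let eb := xc 2 X in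
  let ev := xc 3 X in let ephi := xc 4 X in
  let colv (j : 'I_5) : 'cV[R]_3 :=
    match val j with
    | 0 => vt
    | 1 => m^-1 *: track_rhs p m kT kTD kTP LT bt vt ephi
    | 2 => ev
    | 3 => m^-1 *: obs_rhs p m kt1 kt3 kappat eb ev ephi
    | _ => - (m * kt2) *: phi2 p kt3 (psiv p kappat eb ev)
    end in
  \matrix_(i < 3, j < 5) colv j i 0.

(* x : [0,oo) -> R^{3x5} is a (Caratheodory / absolutely continuous) solution
   of dx/dt = F(x) on [0,oo):  x(t) = x(0) + int_0^t F(x(s)) ds. *)
Definition is_solution (F : 'M[R]_(3, 5) -> 'M[R]_(3, 5))
  (x : R -> 'M[R]_(3, 5)) : Prop :=
  forall t : R, 0 <= t -> forall (i : 'I_3) (j : 'I_5),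
    lebesgue_measure.-integrable `[0, t]%classic (fun s => (F (x s) i j)%:E)
    /\ x t i j = x 0 i j
                 + Rintegral lebesgue_measure `[0, t]%classic
                     (fun s => F (x s) i j).

(* Fast finite-time stability of the origin of dx/dt = F(x):
   Lyapunov stability, plus finite-time convergence governed by a continuous
   positive definite V with  dV/dt <= -l1 V - l2 V^a  (upper right Dini
   derivative along solutions) and settling time
   T <= 1/(l1 (1-a)) ln ((l1 V(x0)^(1-a) + l2)/l2). *)
Definition settling_bound (l1 l2 a v : R) : R :=
  (l1 * (1 - a))^-1 * ln ((l1 * v `^ (1 - a) + l2) / l2).

Definition FFTS (F : 'M[R]_(3, 5) -> 'M[R]_(3, 5)) : Prop :=
  (forall eps : R, 0 < eps -> exists2 delta : R, 0 < delta &
     forall x, is_solution F x -> `|x 0| < delta ->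
       forall t : R, 0 <= t -> `|x t| < eps)
  /\
  exists r : R, exists V : 'M[R]_(3, 5) -> R, exists l1 l2 a : R,
    [/\ 0 < r, 0 < l1, 0 < l2, 0 < a & a < 1]
    /\ continuous V /\ V 0 = 0 /\ (forall z, z != 0 -> 0 < V z)
    /\ forall x, is_solution F x -> `|x 0| < r ->
         (forall t : R, 0 <= t -> forall e : R, 0 < e ->
            exists2 d : R, 0 < d & forall h : R, 0 < h -> h < d ->
              (V (x (t + h)) - V (x t)) / h
                <= - l1 * V (x t) - l2 * (V (x t)) `^ a + e)
         /\ (forall t : R, settling_bound l1 l2 a (V (x 0)) <= t -> x t = 0).

Definition hurwitz (n : nat) (A : 'M[R]_n) : Prop :=
  forall z : R[i], eigenvalue (map_mx (fun r : R => (r%:C)%C) A) z -> 'Re z < 0.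

Definition sym_posdef (n : nat) (A : 'M[R]_n) : Prop :=
  A^T = A /\ forall u : 'cV[R]_n, u != 0 -> 0 < (u^T *m A *m u) 0 0.

Definition is_lmin (n : nat) (A : 'M[R]_n) (l : R) : Prop :=
  eigenvalue A l /\ forall l', eigenvalue A l' -> l <= l'.
Definition is_lmax (n : nat) (A : 'M[R]_n) (l : R) : Prop :=
  eigenvalue A l /\ forall l', eigenvalue A l' -> l' <= l.

Definition At (kt1 kt2 : R) : 'M[R]_2 :=
  \matrix_(i < 2, j < 2)
    (if val i == 0%N then (if val j == 0%N then - kt1 else 1)
     else (if val j == 0%N then - kt2 else 0)).

Definition is_SO3 (Q : 'M[R]_3) : Prop := Q^T *m Q = 1%:M /\ \det Q = 1.

End Defs.
Arguments e3 {R}.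

(* Main.v *)
(* With w = e_phi / m the observer error is psi' = - kt1 phi1(psi) + w,
   w' = - kt2 phi2(psi), and phi2 = (D phi1) phi1, so that zeta = (phi1(psi), w)
   satisfies zeta' = (At (x) D phi1(psi)) zeta.  Hence U = zeta^T Pt zeta decays
   like - kt3 qmin |zeta|^2 - C |zeta|^(2/p), and
     V = m/2 |psi_T|^2 + kTP/2 bt^T LT bt + U + |e_b|^2
   satisfies V' <= - l1 V - l2 V^(1/p) under the gain conditions.

   The vector field is singular where bt = 0 or e_b = 0, and U is not Lipschitz
   where psi = 0.  The first difficulty disappears because the sliding variables
   are C^1 along Caratheodory solutions: the singular term is a dominated limit of
   derivatives of smooth approximations.  For the second, zeros of psi with w != 0
   are isolated, and once psi = w = 0 the energy U stays 0. *)
Require Import Defs.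
From HB Require Import structures.
From mathcomp Require Import all_boot all_order all_algebra.
From mathcomp Require Import all_classical all_reals all_analysis.
From mathcomp Require Import complex.
From mathcomp Require Import ring lra.
Import Order.TTheory GRing.Theory Num.Theory.
Import numFieldNormedType.Exports.
Local Open Scope ring_scope.

(** Every part of [lyap] is dissipated at a linear rate and at power 1/p, the same power throughout:
    pairing x with [satv p x] gives x.x + (x.x)^(1/p), and the exponent c of [phi1] satisfies c / (1
    + 2c) = 1/p - 1, which bounds the weight (psi.psi)^c from below by |zeta|^(2/p - 2).
    Subadditivity of y^(1/p) recombines the parts. The gain conditions are the price of two Young
    inequalities, for the couplings psi_T . e_phi and 2 e_b . psi.

    Integrability of the singular terms is read off the equation itself, all other terms being
    continuous in time. The differential of |x|^(2a) x has the eigenvalues |x|^(2a) and (1 + 2a)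
    |x|^(2a), comparable for a > -1/2, so the singular term dominates its own regularizations.

    Along a solution V is differentiable just after each time t, though perhaps not at t; hence the
    comparison by right Dini derivatives. *)

(** * Monotonicity from right Dini bounds *)

Section Dini.
Context {R : realType}.
Implicit Types (f g : R -> R) (a b c t : R).

Lemma continuous_at_eps (T : R -> R) t : {for t, continuous T} ->
  forall e, 0 < e -> exists2 d, 0 < d & forall s, `|s - t| < d -> `|T s - T t| < e.
Proof.
move=> cT e e0; move/cvgrPdist_lt : cT => /(_ e e0)/nbhs_ballP[d /= d0 dP].
exists d => // s sd; rewrite distrC; apply: dP.
by rewrite /ball /= distrC.
Qed.

Lemma eps_continuous_at (T : R -> R) t :
  (forall e, 0 < e -> exists2 d, 0 < d & forall s, `|s - t| < d -> `|T s - T t| < e) ->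
  {for t, continuous T}.
Proof.
move=> H; apply/cvgrPdist_lt => e /H[d d0 dP]; apply/nbhs_ballP; exists d => //= s.
by rewrite /ball /= distrC => /dP; rewrite distrC.
Qed.

(* Continuity induction on the first time at which f exceeds a line of small
   slope lying above f a; only points with f a < f t can be such times. *)
Lemma dini_le f a b : a <= b ->
  (forall t, a <= t -> t <= b -> {for t, continuous f}) ->
  (forall t, a <= t -> t < b -> f a < f t -> forall e, 0 < e ->
     exists2 d, 0 < d & forall h, 0 < h -> h < d -> f (t + h) <= f t + e * h) ->
  f b <= f a.
Proof.
move=> ab fc fd; rewrite leNgt; apply/negP => fab.
(* With this slope the line [B] reaches the midpoint of f a and f b at [b]; the offset 1 in [B]
   keeps it strictly above f a. *)
pose e := (f b - f a) / (2 * (1 + (b - a))).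
have K0 : 0 < 2 * (1 + (b - a)) by lra.
have e0 : 0 < e by rewrite divr_gt0 // subr_gt0.
have eK : e * (2 * (1 + (b - a))) = f b - f a by rewrite mulfVK // gt_eqF.
pose B s := f a + e * (1 + (s - a)).
pose S := [set s | a <= s <= b /\ B s < f s]%classic.
have Sb : S b.
  split; first by rewrite ab lexx.
  rewrite /B; have : 0 < e * (1 + (b - a)) by rewrite mulr_gt0 //; lra.
  lra.
have lS : lbound S a by move=> s [/andP[]].
have hS : has_inf S by split; [exists b | exists a].
pose c := inf S.
have ac : a <= c by apply: lb_le_inf => //; exists b.
have cb : c <= b by apply: ge_inf => //; exists a.
have cl s : S s -> c <= s by move=> Ss; apply: ge_inf => //; exists a.
have fcc := fc c ac cb.
have Bpos s : a <= s -> f a < B s.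
  by move=> as_; rewrite /B ltrDl mulr_gt0 //; lra.
have BcE s u : B s = B u + e * (s - u) by rewrite /B; ring.
(* Otherwise continuity would put points just left of the infimum [c] into [S]. *)
have fcB : f c <= B c.
  rewrite leNgt; apply/negP => Bf.
  have ac' : a < c.
    rewrite lt_neqAle ac andbT; apply/eqP => ac'; move: Bf; rewrite -ac'.
    by rewrite ltNge ltW // Bpos.
  have [d d0 dP] := continuous_at_eps f c fcc _ (divr_gt0 (etrans (subr_gt0 _ _) Bf) (ltr0n R 2)).
  pose s := Num.max a (c - d / 2).
  have sc : s < c by rewrite /s gt_max ac' /=; lra.
  have as_ : a <= s by rewrite /s le_max lexx.
  have : `|s - c| < d.
    have : c - d / 2 <= s by rewrite /s le_max lexx orbT.
    by move=> h; rewrite ltr_norml; apply/andP; split; lra.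
  move=> /dP; rewrite ltr_norml => /andP[h1 h2].
  have : S s.
    split; first by rewrite as_ /=; lra.
    have := BcE s c; have : 0 < e * (c - s) by rewrite mulr_gt0 // subr_gt0.
    have -> : e * (s - c) = - (e * (c - s)) by ring.
    lra.
  by move/cl; rewrite leNgt sc.
have cb' : c < b.
  rewrite lt_neqAle cb andbT; apply/eqP => cb'.
  by case: Sb => _; rewrite -cb' ltNge fcB.
have [d d0 dP] : exists2 d, 0 < d & forall h, 0 < h -> h < d -> f (c + h) <= B (c + h).
  (* On the line, f a < f c gives access to the Dini bound, used with the slope [e] of [B]; below
     the line, continuity is enough. *)
  move: fcB; rewrite le_eqVlt => /orP[/eqP fcB|fcB].
    have faf : f a < f c by rewrite fcB Bpos.
    have [d d0 dP] := fd c ac cb' faf e e0.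
    exists d => // h h0 /(dP h h0) /le_trans; apply.
    by rewrite (BcE _ c) fcB (_ : c + h - c = h) //; ring.
  have [d d0 dP] := continuous_at_eps f c fcc _ (etrans (subr_gt0 _ _) fcB).
  exists d => // h h0 hd.
  have chc : c + h - c = h by ring.
  have : `|c + h - c| < d by rewrite chc gtr0_norm.
  move=> /dP; rewrite ltr_norml => /andP[h1 h2].
  rewrite (BcE _ c) chc.
  have : 0 < e * h by rewrite mulr_gt0.
  lra.
have [s Ss sc] := inf_adherent d0 hS.
have := cl _ Ss; rewrite le_eqVlt => /orP[/eqP cs|cs].
  by case: Ss => _; rewrite -cs ltNge fcB.
have : f (c + (s - c)) <= B (c + (s - c)) by apply: dP; rewrite -/c in sc *; lra.
rewrite addrC subrK => h; case: Ss => _; by rewrite ltNge h.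
Qed.

(** Mean value theorem on [a, a + h]. It asks for no derivative at [a] itself, which is the
    situation at a time where psi vanishes. *)
Lemma dini_of_derive f k a b : a < b ->
  (forall t, a < t -> t < b -> exists2 l, is_derive t (1 : R) f l & l <= k t) ->
  {for a, continuous f} -> {for a, continuous k} ->
  forall e, 0 < e -> exists2 d, 0 < d & forall h, 0 < h -> h < d ->
    (f (a + h) - f a) / h <= k a + e.
Proof.
move=> ab dfk fa ka e e0.
pose g t : R := 'D_1 f t.
have df t : a < t -> t < b -> is_derive t (1 : R) f (g t).
  by move=> h1 h2; have [l [dl _] _] := dfk t h1 h2; exact: DeriveDef.
have gk t : a < t -> t < b -> g t <= k t.
  by move=> h1 h2; have [l [_ dl] lk] := dfk t h1 h2; rewrite /g dl.
have [d d0 dP] := continuous_at_eps k a ka e e0.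
exists (Num.min d (b - a)); first by rewrite lt_min d0 subr_gt0.
move=> h h0; rewrite lt_min => /andP[hd hb].
have dfc t : a < t -> t < b -> {for t, continuous f}.
  move=> t1 t2; have dt := df t t1 t2.
  by apply: differentiable_continuous; apply/derivable1_diffP.
have [c cah] : exists2 c, c \in `]a, (a + h)[%R & f (a + h) - f a = g c * (a + h - a).
  apply: MVT; first by rewrite ltrDl.
    by move=> x; rewrite in_itv /= => /andP[x1 x2]; apply: df => //; lra.
  apply: continuous_in_subspaceT => x; rewrite inE /= in_itv /= => /andP[].
  rewrite le_eqVlt => /orP[/eqP <- //|x1 x2]; apply: dfc => //; lra.
rewrite (_ : a + h - a = h); last by ring.
move=> ->; rewrite mulfK ?gt_eqF //.
move: cah; rewrite in_itv /= => /andP[c1 c2].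
have := gk c c1; have : `|c - a| < d by rewrite gtr0_norm; lra.
move=> /dP; rewrite ltr_norml => /andP[_ h2] /(_ _); lra.
Qed.

(** By the mean value theorem f t is (t - a) times a value of [g] close to g a, so the zero of [f]
    at [a] is isolated on the right. *)
Lemma right_neq0 f g a : (forall t, a < t -> is_derive t (1 : R) f (g t)) ->
  {for a, continuous f} -> {for a, continuous g} -> f a = 0 -> g a != 0 ->
  exists2 d, 0 < d & forall t, a < t -> t < a + d -> f t != 0.
Proof.
move=> df fa ga f0 g0.
have [d d0 dP] := continuous_at_eps g a ga _ (etrans (normr_gt0 _) g0).
exists d => // t at_ td.
have [c cat] : exists2 c, c \in `]a, t[%R & f t - f a = g c * (t - a).
  apply: MVT => // [x|]; first by rewrite in_itv /= => /andP[x1 x2]; apply: df.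
  apply: continuous_in_subspaceT => x; rewrite inE /= in_itv /= => /andP[].
  rewrite le_eqVlt => /orP[/eqP <- //|x1 x2].
  by have ? := df x x1; apply: differentiable_continuous; apply/derivable1_diffP.
rewrite f0 subr0 => ->; rewrite mulf_neq0 //; last by rewrite gt_eqF // subr_gt0.
move: cat; rewrite in_itv /= => /andP[c1 c2].
have : `|c - a| < d by rewrite gtr0_norm; lra.
by move=> /dP; apply: contraTneq => ->; rewrite sub0r normrN ltxx.
Qed.

End Dini.

(** * Finite settling time for a scalar differential inequality *)

Section Settling.
Context {R : realType}.
Implicit Types (f g : R -> R) (a b c t : R).

Lemma is_derive_eps f a (l : R) : is_derive a (1 : R) f l ->
  forall e, 0 < e -> exists2 d, 0 < d & forall h, `|h| < d ->
    `|f (a + h) - f a - l * h| <= e * `|h|.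
Proof.
move=> [df dl] e e0; move: df; rewrite /derivable; move: dl; rewrite /derive => dl.
move=> /cvg_ex[l' cl']; have l'l : l' = l by rewrite -dl; apply/esym/cvg_lim.
rewrite l'l in cl' => {l'l dl}.
move/cvgrPdist_le : cl' => /(_ e e0) /nbhs_ballP[d /= d0 dP].
exists d => // h hd; have [->|h0] := eqVneq h 0.
  by rewrite !addr0 mulr0 subrr subr0 normr0 mulr0.
have /= := dP h; rewrite /ball /= sub0r normrN => /(_ hd h0).
rewrite !/(_ *: _) /= mulr1 [h + a]addrC => H.
rewrite -(@ler_pM2l _ `|h|^-1) ?invr_gt0 ?normr_gt0 // mulrCA mulVf ?normr_eq0 // mulr1.
apply: le_trans H; rewrite -normfV -normrM distrC mulrBr [l * h]mulrC mulKf //.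
Qed.

(** Antiderivative of 1 / (l1 y + l2 y^al), obtained by separating variables in y' = - l1 y - l2
    y^al; [settling_bound] is its increment from 0 to the initial value. *)
Definition settling_potential (l1 l2 al y : R) :=
  (l1 * (1 - al))^-1 * ln (l1 * y `^ (1 - al) + l2).

Lemma is_derive_settling_potential (l1 l2 al y : R) :
  0 < l1 -> 0 < l2 -> al < 1 -> 0 < y ->
  is_derive y (1 : R) (settling_potential l1 l2 al) (l1 * y + l2 * y `^ al)^-1.
Proof.
move=> l10 l20 al1 y0.
have py := powR_gt0 (1 - al) y0.
have q0 : 0 < l1 * y `^ (1 - al) + l2 by rewrite addr_gt0 // mulr_gt0.
have d1 : is_derive y (1 : R) (fun y => l1 * y `^ (1 - al) + l2)
    (l1 * ((1 - al) * y `^ (1 - al - 1))).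
  have dp := is_derive1_powR (1 - al) y0.
  by apply: is_derive_eq; rewrite addr0.
have d2 : is_derive y (1 : R) (@ln R \o (fun y => l1 * y `^ (1 - al) + l2))
   ((l1 * y `^ (1 - al) + l2)^-1 * (l1 * ((1 - al) * y `^ (1 - al - 1)))).
  by apply: is_derive1_comp; apply: is_derive1_ln.
have d3 := @is_deriveZ R _ _ _ ((l1 * (1 - al))^-1) y 1 _ d2.
apply: is_derive_eq d3 _.
have yE : y `^ al * y `^ (1 - al) = y.
  by rewrite -powRD ?(gt_eqF y0) ?implybT // addrC subrK powRr1 // ltW.
have yE2 : y `^ al * y `^ (1 - al - 1) = 1.
  rewrite -powRD ?(gt_eqF y0) ?implybT //.
  by rewrite (_ : al + (1 - al - 1) = 0) ?powRr0 //; ring.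
have pa := powR_gt0 al y0.
have -> : l1 * y + l2 * y `^ al = y `^ al * (l1 * y `^ (1 - al) + l2).
  by rewrite -{1}yE; ring.
have -> : y `^ (1 - al - 1) = (y `^ al)^-1 by apply: (mulfI (lt0r_neq0 pa)); rewrite yE2 mulfV ?lt0r_neq0.
rewrite /(_ *: _) /=; field; rewrite !lt0r_neq0 //; lra.
Qed.

Lemma le_settling_potential (l1 l2 al y z : R) :
  0 < l1 -> 0 < l2 -> al < 1 -> 0 <= y -> y <= z ->
  settling_potential l1 l2 al y <= settling_potential l1 l2 al z.
Proof.
move=> l10 l20 al1 y0 yz; rewrite /settling_potential.
have z0 : 0 <= z by exact: le_trans yz.
rewrite ler_pM2l ?invr_gt0 ?mulr_gt0 ?subr_gt0 //.
have pp u : 0 < l1 * u `^ (1 - al) + l2 by rewrite ltr_wpDl // mulr_ge0 ?powR_ge0 // ltW.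
rewrite ler_ln ?posrE // lerD2r ler_pM2l // ge0_ler_powR ?nnegrE //; lra.
Qed.

Section DecayingFunction.
Variables (v : R -> R) (l1 l2 al : R).
Hypotheses (l10 : 0 < l1) (l20 : 0 < l2) (al0 : 0 < al) (al1 : al < 1).
Hypotheses (v0 : forall t, 0 <= v t) (vc : continuous v).
Hypothesis vD : forall t, 0 <= t -> forall e, 0 < e ->
  exists2 d, 0 < d & forall h, 0 < h -> h < d ->
    (v (t + h) - v t) / h <= - l1 * v t - l2 * v t `^ al + e.

Lemma dini_decay_le s t : 0 <= s -> s <= t -> v t <= v s.
Proof.
move=> s0 st; apply: dini_le => // [u su ut|u su ut _ e e0]; first exact: vc.
have [d d0 dP] := vD u (le_trans s0 su) e e0.
exists d => // h h0 hd; rewrite -lerBlDl -ler_pdivrMr //.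
apply: le_trans (dP h h0 hd) _.
have := mulr_ge0 (ltW l10) (v0 u).
have := mulr_ge0 (ltW l20) (powR_ge0 (v u) al).
lra.
Qed.

(** If v t were positive, v would be positive on [0, t] and Psi (v s) + s nonincreasing there, Psi
    being the potential. Then Psi (v t) <= Psi 0, against strict monotonicity of Psi. *)
Lemma dini_decay_settling t : settling_bound l1 l2 al (v 0) <= t -> v t = 0.
Proof.
move=> Tt.
have pp y : 0 < l1 * y `^ (1 - al) + l2.
  by rewrite ltr_wpDl // mulr_ge0 ?powR_ge0 // ltW.
have TE : settling_bound l1 l2 al (v 0) =
    settling_potential l1 l2 al (v 0) - settling_potential l1 l2 al 0.
  rewrite /settling_bound /settling_potential ln_div ?posrE // mulrBr.
  by rewrite powR0 ?mulr0 ?add0r // gt_eqF // subr_gt0.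
have t0 : 0 <= t.
  by apply: le_trans Tt; rewrite TE subr_ge0 le_settling_potential.
apply/eqP; rewrite eq_le v0 andbT leNgt; apply/negP => vt.
have vs s : 0 <= s -> s <= t -> 0 < v s.
  by move=> s0 st; apply: lt_le_trans vt _; exact: dini_decay_le.
pose Psi := settling_potential l1 l2 al.
have : Psi (v t) + t <= Psi (v 0) + 0.
  apply: (@dini_le R (fun s => Psi (v s) + s)) => // [s s0 st|s s0 st _ e e0].
    apply: (@continuousD _ _ _ (Psi \o v) id); last exact: cvg_id.
    apply: continuous_comp; first exact: vc.
    have := is_derive_settling_potential _ _ _ _ l10 l20 al1 (vs s s0 st).
    by move=> ?; apply: differentiable_continuous; apply/derivable1_diffP.
  have vs0 := vs s s0 (ltW st).
  have dPsi := is_derive_settling_potential _ _ _ _ l10 l20 al1 vs0.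
  set k := l1 * v s + l2 * v s `^ al in dPsi.
  have k0 : 0 < k by rewrite addr_gt0 // mulr_gt0 // powR_gt0.
  (* The tolerance [e] is split: k * (e / 2) in the bound on v becomes e / 2 after multiplication by
     Psi' = 1 / k, and [e2] below spends the other half on linearizing Psi. *)
  have e1 : 0 < k * (e / 2) by rewrite mulr_gt0 // divr_gt0.
  have [d1 d10 d1P] := vD s s0 _ e1.
  pose q := - k + k * (e / 2).
  pose e2 := e / 2 / (1 + `|q|).
  have Q0 : 0 < 1 + `|q| by rewrite ltr_wpDr.
  have e20 : 0 < e2 by rewrite !divr_gt0.
  have [d2 d20 d2P] := is_derive_eps _ _ _ dPsi e2 e20.
  exists (Num.min (Num.min d1 (t - s)) (d2 / (1 + `|q|))).
    by rewrite !lt_min d10 subr_gt0 st divr_gt0.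
  move=> h h0; rewrite !lt_min => /andP[/andP[hd1 hts] hd2].
  have vh : v (s + h) <= v s + h * q.
    rewrite -lerBlDl mulrC -ler_pdivrMr //; apply: le_trans (d1P h h0 hd1) _.
    by rewrite /q /k; lra.
  have : Psi (v (s + h)) <= Psi (v s + h * q).
    by apply: le_settling_potential.
  have hq : `|h * q| <= h * (1 + `|q|).
    by rewrite normrM gtr0_norm // ler_pM2l // lerDr.
  have : `|h * q| < d2 by apply: le_lt_trans hq _; rewrite -ltr_pdivlMr.
  move=> /d2P; rewrite ler_norml => /andP[_ H2].
  have e2E : e2 * `|h * q| <= e / 2 * h.
    apply: le_trans (ler_wpM2l (ltW e20) hq) _.
    by rewrite mulrCA /e2 mulfVK ?gt_eqF // mulrC.
  have kE : k^-1 * (h * q) = - h + h * (e / 2).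
    by rewrite /q; field; rewrite gt_eqF.
  rewrite -/Psi in H2; lra.
move: Tt; rewrite TE -/Psi => Tt H.
suff : Psi 0 < Psi (v t) by lra.
rewrite /Psi /settling_potential ltr_pM2l ?invr_gt0 ?mulr_gt0 ?subr_gt0 //.
by rewrite ltr_ln ?posrE // ltrD2r ltr_pM2l // powR0 ?powR_gt0 // gt_eqF // subr_gt0.
Qed.

End DecayingFunction.
End Settling.

(** * Integral equations on [0, t] *)

Section Primitive.
Context {R : realType}.
Local Notation mu := (@lebesgue_measure R).

Definition primitive_of (y g : R -> R) := forall t : R, 0 <= t ->
  mu.-integrable `[0, t]%classic (EFin \o g) /\
  y t = y 0 + Rintegral mu `[0, t]%classic g.

Lemma primitive_of_derive y g t : primitive_of y g -> 0 < t ->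
  {for t, continuous g} -> is_derive t (1 : R) y (g t).
Proof.
move=> yg t0 gt.
have t1 : t < t + 1 by lra.
have t10 : 0 <= t + 1 by lra.
have [ig _] := yg _ t10.
have [d1 d2] := continuous_FTC1_closed t1 ig t0 gt.
have dF : is_derive t (1 : R) (fun x => y 0 + Rintegral mu `[0, x]%classic g) (g t).
  have dG : is_derive t (1 : R) (fun x => Rintegral mu `[0, x]%classic g) (g t).
    by apply: (DeriveDef d1); rewrite -derive1E; exact: d2.
  rewrite -[g t]add0r; exact: (is_deriveD (is_derive_cst _ _ _) dG).
apply: near_eq_is_derive dF.
near=> s; have [|_ ->//] := yg s.
by near: s; apply: (filterS (P:=[set z | 0 < z]%classic)) => [z /ltW//|]; exact: lt_nbhsr.
Unshelve. all: by end_near.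
Qed.

(** The integral equation says nothing at negative times; freezing the function at its initial value
    there makes it continuous on the whole line. *)
Lemma primitive_of_continuous y g : primitive_of y g ->
  continuous (fun t : R => y (Num.max t 0)).
Proof.
move=> yg t.
apply: eps_continuous_at => e e0.
pose b := `|t| + 1.
have tb : t <= `|t| := ler_norm t.
have b0 : 0 <= b by rewrite addr_ge0.
have [ig _] := yg b b0.
have /subspace_continuousP := parameterized_integral_continuous b0 ig.
have mb s : s <= b -> 0 <= Num.max s 0 <= b by move=> sb; rewrite le_max lexx orbT ge_max sb.
move=> /(_ (Num.max t 0)) /=; rewrite in_itv /= mb ?/b; last lra.
move=> /(_ isT) /cvgrPdist_lt /(_ e e0) /nbhs_ballP[d /= d0 dP].
exists (Num.min d 1); first by rewrite lt_min d0 ltr01.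
move=> s; rewrite lt_min => /andP[sd s1].
have sb : s <= b by rewrite /b; move: s1; rewrite ltr_norml; lra.
have [_ ->] := yg (Num.max s 0) ltac:(by rewrite le_max lexx orbT).
have [_ ->] := yg (Num.max t 0) ltac:(by rewrite le_max lexx orbT).
rewrite opprD addrACA subrr add0r distrC.
apply: dP; last by rewrite /= in_itv /= mb.
rewrite /ball /=; apply: le_lt_trans sd; rewrite [X in _ <= X]distrC.
have h1 := ler_norm (t - s); have h2 := ler_norm (s - t); rewrite distrC in h2.
rewrite !maxElt ler_norml.
by case: (ltP t 0) => h3; case: (ltP s 0) => h4; apply/andP; split; lra.
Qed.

Lemma continuous_integrable_itv (g : R -> R) t : continuous g ->
  mu.-integrable `[0, t]%classic (EFin \o g).
Proof.
move=> gc; apply: continuous_compact_integrable; first exact: segment_compact.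
exact: continuous_subspaceT.
Qed.

Lemma integrable_addf (t : R) (f g : R -> R) :
  mu.-integrable `[0, t]%classic (EFin \o f) ->
  mu.-integrable `[0, t]%classic (EFin \o g) ->
  mu.-integrable `[0, t]%classic (EFin \o (fun s => f s + g s)).
Proof. by move=> hf hg; have := @integrableD _ _ _ _ _ _ _ _ hf hg; apply; exact: measurable_itv. Qed.

Lemma integrable_scalef (t k : R) (f : R -> R) :
  mu.-integrable `[0, t]%classic (EFin \o f) ->
  mu.-integrable `[0, t]%classic (EFin \o (fun s => k * f s)).
Proof. by move=> hf; have := @integrableZl _ _ _ _ _ _ k _ hf; apply; exact: measurable_itv. Qed.

End Primitive.

(** * Differentiation rules for scalar and vector functions of time *)

Section ScalarCalculus.
Context {R : realType}.
Implicit Types (f g : R -> R) (t a : R).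

Lemma is_derive_addf f g t (df dg : R) : is_derive t (1 : R) f df ->
  is_derive t (1 : R) g dg -> is_derive t (1 : R) (fun s => f s + g s) (df + dg).
Proof. by move=> ? ?; exact: is_deriveD. Qed.

Lemma is_derive_mulf f g t (df dg : R) : is_derive t (1 : R) f df ->
  is_derive t (1 : R) g dg ->
  is_derive t (1 : R) (fun s => f s * g s) (df * g t + f t * dg).
Proof.
move=> hf hg; have h := is_deriveM hf hg.
by apply: is_derive_eq h _; rewrite /GRing.scale /=; ring.
Qed.

Lemma is_derive_scalef (k : R) f t (df : R) : is_derive t (1 : R) f df ->
  is_derive t (1 : R) (fun s => k * f s) (k * df).
Proof. by move=> hf; exact: is_deriveZ. Qed.

Lemma is_derive_powf f t (df : R) a : is_derive t (1 : R) f df -> 0 < f t ->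
  is_derive t (1 : R) (fun s => f s `^ a) (a * f t `^ (a - 1) * df).
Proof. by move=> hf f0; exact: (is_derive1_comp (is_derive1_powR a f0) hf). Qed.

Lemma is_derive_continuous f t (df : R) : is_derive t (1 : R) f df ->
  {for t, continuous f}.
Proof. by move=> ?; apply: differentiable_continuous; apply/derivable1_diffP. Qed.

Lemma continuous_powR (a x : R) : 0 < x -> {for x, continuous (fun y : R => y `^ a)}.
Proof. by move=> x0; apply: is_derive_continuous (is_derive1_powR a x0). Qed.

End ScalarCalculus.

Section Vectors.
Context {R : realType}.
Implicit Types (x y : 'cV[R]_3) (a k : R).

Lemma ord3_ind (P : 'I_3 -> Prop) : P 0 -> P 1 -> P 2 -> forall i, P i.
Proof.
by move=> P0 P1 P2 [[|[|[|//]]] h];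
  [move: P0|move: P1|move: P2]; congr P; apply/val_inj.
Qed.

Lemma dotv_sum x y : dotv x y = \sum_i x i 0 * y i 0.
Proof. by rewrite /dotv mxE; apply: eq_bigr => i _; rewrite mxE. Qed.

Lemma dotvE x y : dotv x y = x 0 0 * y 0 0 + x 1 0 * y 1 0 + x 2 0 * y 2 0.
Proof.
rewrite dotv_sum !big_ord_recl big_ord0 addr0 addrA.
by congr (_ + _ * _ + _ * _); congr (_ _ _); apply/val_inj.
Qed.

Lemma dotvv_ge0 x : 0 <= dotv x x.
Proof. by rewrite dotv_sum sumr_ge0 // => i _; rewrite -expr2 sqr_ge0. Qed.

Lemma sqr_le_dotvv x i : x i 0 ^+ 2 <= dotv x x.
Proof.
rewrite dotv_sum (bigD1 i) //= expr2 lerDl sumr_ge0 // => j _.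
by rewrite -expr2 sqr_ge0.
Qed.

Lemma dotvv_eq0 x : dotv x x = 0 -> x = 0.
Proof.
move=> x0; apply/colP => i; rewrite mxE; apply/eqP; rewrite -sqrf_eq0.
by rewrite eq_le sqr_ge0 andbT -x0 sqr_le_dotvv.
Qed.

Lemma colv_neq0 x : x != 0 -> exists i, x i 0 != 0.
Proof.
move=> x0; apply: contrapT => h; move/eqP: x0; apply; apply/colP => i.
by rewrite [RHS]mxE; apply/eqP; apply: contrapT => /negP hi; apply: h; exists i.
Qed.

Lemma dotvv_gt0 x : x != 0 -> 0 < dotv x x.
Proof.
move=> x0; rewrite lt_neqAle dotvv_ge0 andbT eq_sym.
by apply: contra x0 => /eqP/dotvv_eq0 ->.
Qed.

Lemma dotv00 : dotv (0 : 'cV[R]_3) 0 = 0.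
Proof. by rewrite dotvE !mxE !mulr0 !addr0. Qed.

(** Differential of [spow _ a] at a nonzero [x] in direction [y]. At x = 0 it is 0 when a != 0,
    since 0 to a nonzero power is 0. *)
Definition dspow a x y : 'cV[R]_3 :=
  dotv x x `^ a *: (y + (2 * a * dotv x y / dotv x x) *: x).

Lemma dspowE a x y i : dspow a x y i 0 =
  dotv x x `^ a * (y i 0 + 2 * a * dotv x y / dotv x x * x i 0).
Proof. by rewrite !mxE. Qed.

Lemma spowE a x i : spow x a i 0 = dotv x x `^ a * x i 0.
Proof. by rewrite !mxE. Qed.

(** [Hmat] with k = (p - 1) / p is, up to the factor (x.x)^a, the differential of (x.x)^a x for a =
    (1 - p) / p = - k. *)
Lemma dsatvE p x y : p != 0 -> dsatv p x y = y + dspow ((1 - p) / p) x y.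
Proof.
move=> p0; rewrite /dsatv /dspow; congr (_ + _ *: _).
rewrite /Hmat mulmxBl mul1mx -scalemxAl -mulmxA.
have -> : x^T *m y = (dotv x y)%:M by apply: mx11_scalar.
rewrite mul_mx_scalar scalerA -scaleNr; congr (_ + _ *: _).
by rewrite -[1 - p]opprB !(mulrN, mulNr); congr (- _); rewrite mulrAC.
Qed.

End Vectors.

Section VectorCalculus.
Context {R : realType}.
Implicit Types (e v f w : R -> 'cV[R]_3) (t a : R).

Definition is_cderive e t (l : 'cV[R]_3) :=
  forall i, is_derive t (1 : R) (fun s => e s i 0) (l i 0).

Definition ccontinuous e := forall i, continuous (fun s => e s i 0).

Lemma is_derive_dotv e f t l k : is_cderive e t l -> is_cderive f t k ->
  is_derive t (1 : R) (fun s => dotv (e s) (f s)) (dotv l (f t) + dotv (e t) k).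
Proof.
move=> he hf; rewrite (_ : (fun s => _) = (fun s => e s 0 0 * f s 0 0 +
  e s 1 0 * f s 1 0 + e s 2 0 * f s 2 0)); last by apply/funext => s; rewrite dotvE.
have := is_derive_addf _ _ _ _ _ (is_derive_addf _ _ _ _ _
  (is_derive_mulf _ _ _ _ _ (he 0) (hf 0)) (is_derive_mulf _ _ _ _ _ (he 1) (hf 1)))
  (is_derive_mulf _ _ _ _ _ (he 2) (hf 2)).
by move=> h; apply: is_derive_eq h _; rewrite !dotvE; ring.
Qed.

Lemma is_derive_dotvv e t l : is_cderive e t l ->
  is_derive t (1 : R) (fun s => dotv (e s) (e s)) (2 * dotv (e t) l).
Proof.
by move=> he; apply: is_derive_eq (is_derive_dotv _ _ _ _ _ he he) _; rewrite !dotvE; ring.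
Qed.

Lemma continuous_at_dotv (T : topologicalType) (e f : T -> 'cV[R]_3) (t : T) :
  (forall i, {for t, continuous (fun s => e s i 0)}) ->
  (forall i, {for t, continuous (fun s => f s i 0)}) ->
  {for t, continuous (fun s => dotv (e s) (f s))}.
Proof.
move=> he hf; rewrite (_ : (fun s => _) = (fun s => e s 0 0 * f s 0 0 +
  e s 1 0 * f s 1 0 + e s 2 0 * f s 2 0)); last by apply/funext => s; rewrite dotvE.
by apply: cvgD; [apply: cvgD|]; apply: cvgM; first [exact: he | exact: hf].
Qed.

Lemma is_cderive_spow e t l a : is_cderive e t l -> e t != 0 ->
  is_cderive (fun s => spow (e s) a) t (dspow a (e t) l).
Proof.
move=> he et0 i.
have r0 := dotvv_gt0 _ et0.
rewrite (_ : (fun s => _) = (fun s => dotv (e s) (e s) `^ a * e s i 0)); last first.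
  by apply/funext => s; rewrite spowE.
have h := is_derive_mulf _ _ _ _ _ (is_derive_powf _ _ _ a (is_derive_dotvv _ _ _ he) r0) (he i).
apply: is_derive_eq h _; rewrite dspowE.
have -> : dotv (e t) (e t) `^ a = dotv (e t) (e t) `^ (a - 1) * dotv (e t) (e t).
  by rewrite -{3}[dotv (e t) (e t)]powRr1 ?ltW // -powRD ?subrK // (gt_eqF r0) implybT.
by field; rewrite gt_eqF.
Qed.

End VectorCalculus.

(** * Regularization of the singular power and a domination uniform in [eps] *)

Section SpowPrimitive.
Context {R : realType}.
Local Notation mu := (@lebesgue_measure R).
Implicit Types (a eps r t : R).

(* Smooth approximation of [r `^ a] on [0, +oo[ that vanishes at [r = 0], so
   that the approximation of [spow] is stationary whenever its argument is 0. *)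
Definition powreg a eps r : R := r * (r + eps) `^ (a - 1).
Definition dpowreg a eps r : R :=
  (r + eps) `^ (a - 1) + (a - 1) * r * (r + eps) `^ (a - 2).

Lemma is_derive_powreg a eps (f : R -> R) t (df : R) :
  is_derive t (1 : R) f df -> 0 < f t + eps ->
  is_derive t (1 : R) (fun s => powreg a eps (f s)) (dpowreg a eps (f t) * df).
Proof.
move=> hf f0; rewrite /powreg.
have he : is_derive t (1 : R) (fun s => f s + eps) df.
  by rewrite -[df]addr0; apply: is_derive_addf => //; exact: is_derive_cst.
have h := is_derive_mulf _ _ _ _ _ hf (is_derive_powf _ _ _ (a - 1) he f0).
apply: is_derive_eq h _; rewrite /dpowreg (_ : a - 1 - 1 = a - 2); last by ring.
ring.
Qed.

Lemma powreg_ge0 a eps r : 0 <= r -> 0 <= powreg a eps r.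
Proof. by move=> r0; rewrite mulr_ge0 ?powR_ge0. Qed.

Lemma powRB1 a r : 0 < r -> r * r `^ (a - 1) = r `^ a.
Proof.
by move=> r0; rewrite -{1}[r]powRr1 ?ltW // -powRD ?(gt_eqF r0) ?implybT // addrC subrK.
Qed.

Lemma powR_le_shift a eps r : a <= 0 -> 0 < r -> 0 <= eps -> (r + eps) `^ a <= r `^ a.
Proof.
move=> a0 r0 e0; have re0 : 0 < r + eps by lra.
have b0 : 0 <= - a by rewrite oppr_ge0.
rewrite -[a]opprK; move: (- a) b0 => b b0; rewrite !powRN.
by rewrite lef_pV2 ?posrE ?powR_gt0 // ge0_ler_powR ?nnegrE ?lerDl // ltW.
Qed.

Lemma powreg_le a eps r : a < 0 -> 0 < r -> 0 <= eps -> powreg a eps r <= r `^ a.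
Proof.
move=> a0 r0 e0; rewrite -powRB1 // ler_pM2l // powR_le_shift //; lra.
Qed.

(** The factor r of the second term is absorbed by r <= r + eps, and a negative power only grows
    when eps is dropped. *)
Lemma dpowreg_le a eps r : a < 0 -> 0 < r -> 0 <= eps ->
  `|dpowreg a eps r| <= (2 - a) * r `^ (a - 1).
Proof.
move=> a0 r0 e0.
have re0 : 0 < r + eps by lra.
have q0 : r * (r + eps) `^ (a - 2) <= (r + eps) `^ (a - 1).
  have -> : (r + eps) `^ (a - 1) = (r + eps) * (r + eps) `^ (a - 2).
    by rewrite -(powRB1 (a - 1)) // (_ : a - 1 - 1 = a - 2) //; ring.
  by rewrite ler_wpM2r ?powR_ge0 //; lra.
have q1 : (r + eps) `^ (a - 1) <= r `^ (a - 1) by rewrite powR_le_shift //; lra.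
apply: le_trans (ler_normD _ _) _; rewrite ger0_norm ?powR_ge0 //.
rewrite -mulrA normrM ler0_norm; last lra.
rewrite ger0_norm; last by rewrite mulr_ge0 ?powR_ge0 // ltW.
have : - (a - 1) * (r * (r + eps) `^ (a - 2)) <= - (a - 1) * r `^ (a - 1).
  by rewrite ler_wpM2l; lra.
lra.
Qed.

Definition spowreg a eps (x : 'cV[R]_3) : 'cV[R]_3 := powreg a eps (dotv x x) *: x.
Definition dspowreg a eps (x y : 'cV[R]_3) i : R :=
  powreg a eps (dotv x x) * y i 0 + dpowreg a eps (dotv x x) * (2 * dotv x y) * x i 0.

(** The dominating function has to be free of eps and integrable along a solution; the size of the
    singular term [dspow] itself serves. The constant blows up as a tends to -1/2, where the
    differential of [spow] ceases to be invertible. *)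
Lemma dspowreg_le a eps (x y : 'cV[R]_3) i : - 2^-1 < a -> a < 0 -> 0 <= eps ->
  `|dspowreg a eps x y i| <= (1 + 10 / (1 + 2 * a)) *
     (`|dspow a x y 0 0| + `|dspow a x y 1 0| + `|dspow a x y 2 0|).
Proof.
move=> a1 a0 e0; set S := _ + _ + _.
have S0 : 0 <= S by rewrite !addr_ge0.
have b0 : 0 < 1 + 2 * a by lra.
have [->|x0] := eqVneq x 0.
  rewrite /dspowreg /powreg dotv00 mul0r mul0r !mxE mulr0 addr0 normr0.
  by rewrite mulr_ge0 // addr_ge0 // divr_ge0 // ltW.
have r0 := dotvv_gt0 _ x0.
set r := dotv x x in r0 *; set q := dotv x y.
have Si j : `|dspow a x y j 0| <= S.
  by rewrite /S; move: j; apply: ord3_ind;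
    rewrite ?lerDr -?addrA ?lerDl ?addr_ge0 // ?lerDr // addrCA lerDl addr_ge0.
have xi j : `|x j 0| * `|x i 0| <= r.
  have h1 := sqr_le_dotvv x j; have h2 := sqr_le_dotvv x i; rewrite -/r in h1 h2.
  rewrite -real_normK ?num_real // in h1; rewrite -real_normK ?num_real // in h2.
  have := sqr_ge0 (`|x j 0| - `|x i 0|); rewrite sqrrB; lra.
have ra : r `^ a = r * r `^ (a - 1) by rewrite powRB1.
have p1 := powR_gt0 (a - 1) r0.
(* Pairing [dspow] with [x] isolates q = x . y, with the positive factor 1 + 2a. *)
have E : x 0 0 * dspow a x y 0 0 + x 1 0 * dspow a x y 1 0 + x 2 0 * dspow a x y 2 0
   = (1 + 2 * a) * q * r * r `^ (a - 1).
  rewrite !dspowE -/r -/q ra.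
  have rE : r = x 0 0 ^+ 2 + x 1 0 ^+ 2 + x 2 0 ^+ 2 by rewrite /r dotvE; ring.
  have qE : q = x 0 0 * y 0 0 + x 1 0 * y 1 0 + x 2 0 * y 2 0 by rewrite /q dotvE.
  transitivity (r * r `^ (a - 1) * ((x 0 0 * y 0 0 + x 1 0 * y 1 0 + x 2 0 * y 2 0)
     + 2 * a * q / r * (x 0 0 ^+ 2 + x 1 0 ^+ 2 + x 2 0 ^+ 2))); first ring.
  by rewrite -qE -rE; field; rewrite gt_eqF.
have T : r `^ (a - 1) * `|q| * `|x i 0| <= S / (1 + 2 * a).
  rewrite ler_pdivlMr // -(ler_pM2l r0).
  have -> : r * (r `^ (a - 1) * `|q| * `|x i 0| * (1 + 2 * a)) =
     `|(1 + 2 * a) * q * r * r `^ (a - 1)| * `|x i 0|.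
    by rewrite !normrM (gtr0_norm b0) (gtr0_norm r0) (gtr0_norm p1); ring.
  rewrite -E.
  have h j : `|x j 0 * dspow a x y j 0| * `|x i 0| <= r * `|dspow a x y j 0|.
    by rewrite normrM mulrAC ler_wpM2r.
  have : `|x 0 0 * dspow a x y 0 0 + x 1 0 * dspow a x y 1 0 + x 2 0 * dspow a x y 2 0|
       * `|x i 0| <= (`|x 0 0 * dspow a x y 0 0| + `|x 1 0 * dspow a x y 1 0|
       + `|x 2 0 * dspow a x y 2 0|) * `|x i 0|.
    rewrite ler_wpM2r //; apply: le_trans (ler_normD _ _) _.
    by rewrite lerD2r ler_normD.
  move/le_trans; apply; rewrite !mulrDl /S !mulrDr.
  by rewrite !lerD.
(* [y] is recovered from [dspow] by subtracting the radial part just bounded. *)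
have V : r `^ a * `|y i 0| <= S + S / (1 + 2 * a).
  have yE : r `^ a * y i 0 = dspow a x y i 0 - 2 * a * (r `^ (a - 1) * q * x i 0).
    by rewrite dspowE -/r -/q ra; field; rewrite gt_eqF.
  have -> : r `^ a * `|y i 0| = `|r `^ a * y i 0|.
    by rewrite normrM ger0_norm // powR_ge0.
  rewrite yE; apply: le_trans (ler_normB _ _) _; apply: lerD; first exact: Si.
  rewrite normrM; apply: le_trans T; rewrite !normrM (gtr0_norm p1).
  rewrite -[X in _ <= X]mul1r ler_wpM2r ?mulr_ge0 ?powR_ge0 //.
  by rewrite -normrM ler_norml; apply/andP; split; lra.
rewrite /dspowreg -/r -/q; apply: le_trans (ler_normD _ _) _.
have A1 : `|powreg a eps r * y i 0| <= r `^ a * `|y i 0|.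
  by rewrite normrM ger0_norm ?powreg_ge0 ?(ltW r0) // ler_wpM2r // powreg_le.
have A2 : `|dpowreg a eps r * (2 * q) * x i 0| <= 2 * (2 - a) * (S / (1 + 2 * a)).
  rewrite !normrM (ger0_norm (ler0n _ 2)).
  have -> : `|dpowreg a eps r| * (2 * `|q|) * `|x i 0| =
     2 * (`|dpowreg a eps r| * (`|q| * `|x i 0|)) by ring.
  rewrite -mulrA ler_pM2l //.
  apply: le_trans (ler_wpM2r _ (dpowreg_le a eps r a0 r0 e0)) _; first by rewrite mulr_ge0.
  by rewrite -mulrA ler_pM2l ?mulrA //; lra.
have A3 : 2 * (2 - a) * (S / (1 + 2 * a)) <= 9 * (S / (1 + 2 * a)).
  by rewrite ler_wpM2r ?divr_ge0 ?(ltW b0) //; lra.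
have -> : (1 + 10 / (1 + 2 * a)) * S = S + S / (1 + 2 * a) + 9 * (S / (1 + 2 * a)).
  by field; rewrite gt_eqF.
lra.
Qed.

Section Trajectory.
Variables (e v : R -> 'cV[R]_3) (a : R).
Hypotheses (a1 : - 2^-1 < a) (a0 : a < 0).
Hypotheses (ec : ccontinuous e) (vc : ccontinuous v).
Hypothesis ed : forall t : R, 0 < t -> is_cderive e t (v t).

Lemma spowreg_continuous eps i : 0 < eps ->
  continuous (fun s => spowreg a eps (e s) i 0).
Proof.
move=> eps0 t; rewrite (_ : (fun s => _) =
    (fun s => dotv (e s) (e s) * (dotv (e s) (e s) + eps) `^ (a - 1) * e s i 0)); last first.
  by apply/funext => s; rewrite mxE.
have rc : {for t, continuous (fun s => dotv (e s) (e s))}.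
  by apply: continuous_at_dotv => j; exact: ec.
apply: cvgM; last exact: ec.
apply: cvgM; first exact: rc.
apply: (@continuous_comp _ _ _ (fun s => dotv (e s) (e s) + eps) (fun y => y `^ (a - 1))).
  by apply: cvgD; [exact: rc|exact: cvg_cst].
by apply: continuous_powR; rewrite ltr_wpDl // dotvv_ge0.
Qed.

Lemma dspowreg_continuous eps i : 0 < eps ->
  continuous (fun s => dspowreg a eps (e s) (v s) i).
Proof.
move=> eps0 t; rewrite /dspowreg /powreg /dpowreg.
have rc : {for t, continuous (fun s => dotv (e s) (e s))}.
  by apply: continuous_at_dotv => j; exact: ec.
have qc : {for t, continuous (fun s => dotv (e s) (v s))}.
  by apply: continuous_at_dotv => j; [exact: ec|exact: vc].
have pc b : {for t, continuous (fun s => (dotv (e s) (e s) + eps) `^ b)}.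
  apply: (@continuous_comp _ _ _ (fun s => dotv (e s) (e s) + eps) (fun y => y `^ b)).
    by apply: cvgD; [exact: rc|exact: cvg_cst].
  by apply: continuous_powR; rewrite ltr_wpDl // dotvv_ge0.
by apply: cvgD; apply: cvgM; try exact: ec; try exact: vc;
  [apply: cvgM; [exact: rc|exact: pc]|]; apply: cvgM;
  [apply: cvgD; [exact: pc|]; apply: cvgM; [|exact: pc];
   apply: cvgM; [exact: cvg_cst|exact: rc]|
   apply: cvgM; [exact: cvg_cst|exact: qc]].
Qed.

Lemma is_derive_spowreg eps i t : 0 < eps -> 0 < t ->
  is_derive t (1 : R) (fun s => spowreg a eps (e s) i 0) (dspowreg a eps (e t) (v t) i).
Proof.
move=> eps0 t0; rewrite (_ : (fun s => _) =
    (fun s => powreg a eps (dotv (e s) (e s)) * e s i 0)); last first.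
  by apply/funext => s; rewrite mxE.
have h := is_derive_mulf _ _ _ _ _ (is_derive_powreg a eps _ _ _ (is_derive_dotvv _ _ _ (ed t t0)) _) (ed t t0 i).
by apply: is_derive_eq (h _) _; [rewrite ltr_wpDl // dotvv_ge0|rewrite /dspowreg addrC].
Qed.

End Trajectory.
End SpowPrimitive.

(** * The limit eps -> 0 under the integral *)

Section SpowIntegral.
Local Open Scope classical_set_scope.
Context {R : realType}.
Local Notation mu := (@lebesgue_measure R).
Local Notation epsn := (fun n : nat => (n.+1%:R : R)^-1).

Lemma powreg_cvg (a r : R) : 0 < r -> powreg a (epsn n) r @[n --> \oo] --> r `^ a.
Proof.
move=> r0; rewrite -powRB1 //; apply: cvgM; first exact: cvg_cst.
apply: (@continuous_cvg nat R R \oo _ (fun n => r + epsn n) (fun y : R => y `^ (a - 1))).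
  exact: continuous_powR.
rewrite -[X in _ --> X]addr0; apply: cvgD; [exact: cvg_cst|exact: cvg_harmonic].
Qed.

Lemma dpowreg_cvg (a r : R) : 0 < r ->
  dpowreg a (epsn n) r @[n --> \oo] --> a * r `^ (a - 1).
Proof.
move=> r0.
have H b : (r + epsn n) `^ b @[n --> \oo] --> r `^ b.
  apply: (@continuous_cvg nat R R \oo _ (fun n => r + epsn n) (fun y : R => y `^ b)).
    exact: continuous_powR.
  rewrite -[X in _ --> X]addr0; apply: cvgD; [exact: cvg_cst|exact: cvg_harmonic].
have -> : a * r `^ (a - 1) = r `^ (a - 1) + (a - 1) * r * r `^ (a - 2).
  rewrite -(powRB1 (a - 1)) // (_ : a - 1 - 1 = a - 2); last by ring.
  ring.
by apply: cvgD; [exact: H|apply: cvgM; [exact: cvg_cst|exact: H]].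
Qed.

Lemma spowreg_cvg (a : R) (x : 'cV[R]_3) i :
  spowreg a (epsn n) x i 0 @[n --> \oo] --> spow x a i 0.
Proof.
have [->|x0] := eqVneq x 0.
  by under eq_fun do rewrite !mxE mulr0; rewrite !mxE mulr0; exact: cvg_cst.
under eq_fun do rewrite mxE; rewrite spowE.
by apply: cvgM; [apply: powreg_cvg; exact: dotvv_gt0|exact: cvg_cst].
Qed.

(** Both sides vanish where x = 0, so convergence holds at every time, including the zeros of the
    trajectory. *)
Lemma dspowreg_cvg (a : R) (x y : 'cV[R]_3) i : a != 0 ->
  dspowreg a (epsn n) x y i @[n --> \oo] --> dspow a x y i 0.
Proof.
move=> a0; have [->|x0] := eqVneq x 0.
  rewrite dspowE dotv00 powR0 // mul0r.
  under eq_fun do rewrite /dspowreg /powreg dotv00 mul0r mul0r !mxE mulr0 addr0.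
  exact: cvg_cst.
have r0 := dotvv_gt0 _ x0.
have -> : dspow a x y i 0 = dotv x x `^ a * y i 0 +
    a * dotv x x `^ (a - 1) * (2 * dotv x y) * x i 0.
  by rewrite dspowE -powRB1 //; field; rewrite gt_eqF.
by apply: cvgD; apply: cvgM; try exact: cvg_cst;
  [exact: powreg_cvg|apply: cvgM; [exact: dpowreg_cvg|exact: cvg_cst]].
Qed.

(* Dominated convergence in the fundamental theorem of calculus for [spowreg]. *)
Lemma spow_primitive (e v : R -> 'cV[R]_3) (a : R) :
  - 2^-1 < a -> a < 0 -> ccontinuous e -> ccontinuous v ->
  (forall t : R, 0 < t -> is_cderive e t (v t)) ->
  (forall (t : R) i, 0 <= t -> mu.-integrable `[0, t]%classic
     (EFin \o (fun s => dspow a (e s) (v s) i 0))) ->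
  forall i, primitive_of (fun s => spow (e s) a i 0) (fun s => dspow a (e s) (v s) i 0).
Proof.
move=> a1 a0 ec vc ed iJ i t t0; split; first exact: iJ.
move: t0; rewrite le_eqVlt => /orP[/eqP <-|t0].
  by rewrite set_itv1 Rintegral_set1 addr0.
have en n : 0 < epsn n by rewrite invr_gt0 ltr0n.
pose K n s := dspowreg a (epsn n) (e s) (v s) i.
have IK n : (\int[mu]_(s in `[0%R, t]%classic) (K n s)%:E)%E =
    (spowreg a (epsn n) (e t) i 0 - spowreg a (epsn n) (e 0) i 0)%:E.
  rewrite EFinB; apply: (@continuous_FTC2 _ _ (fun s => spowreg a (epsn n) (e s) i 0)) => //.
  - apply: continuous_subspaceT; exact: dspowreg_continuous.
  - split => [s|| ].
    + rewrite in_itv /= => /andP[s0 _].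
      by have [] := is_derive_spowreg _ _ a ed (epsn n) i s (en n) s0.
    + by apply: cvg_at_right_filter; exact: spowreg_continuous.
    + by apply: cvg_at_left_filter; exact: spowreg_continuous.
  - move=> s; rewrite in_itv /= => /andP[s0 _].
    by rewrite derive1E; have [_ ->] := is_derive_spowreg _ _ a ed (epsn n) i s (en n) s0.
pose C := 1 + 10 / (1 + 2 * a).
pose J j s := dspow a (e s) (v s) j 0.
pose g s := C * (`|J 0 s| + `|J 1 s| + `|J 2 s|).
have iJn j : mu.-integrable `[0, t]%classic (EFin \o (fun s => `|J j s|)).
  exact: (integrable_norm (iJ t j (ltW t0))).
have ig : mu.-integrable `[0, t]%classic (EFin \o g).
  exact: (integrable_scalef _ _ _ (integrable_addf _ _ _
    (integrable_addf _ _ _ (iJn 0) (iJn 1)) (iJn 2))).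
have [|n||||_ _] := @dominated_convergence _ _ _ mu `[0%R, t]%classic _
  (fun n => EFin \o K n) (EFin \o J i) (EFin \o g) _ _ _ ig _.
- exact: measurable_itv.
- have /integrableP[] // : mu.-integrable `[0, t]%classic (EFin \o K n).
  by apply: continuous_integrable_itv; exact: dspowreg_continuous.
- by have /integrableP[] := iJ t i (ltW t0).
- apply: aeW => s _; apply: cvg_EFin; first by near=> n.
  exact: dspowreg_cvg (negbT (lt_eqF a0)).
- apply: aeW => s n _; rewrite /= lee_fin.
  by apply: dspowreg_le => //; exact/ltW.
rewrite (_ : (fun n => _) = EFin \o (fun n => spowreg a (epsn n) (e t) i 0 -
   spowreg a (epsn n) (e 0) i 0)); last by apply/funext => n; rewrite /= -IK.
have : (EFin \o (fun n => spowreg a (epsn n) (e t) i 0 - spowreg a (epsn n) (e 0) i 0)) n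
   @[n --> \oo] --> (spow (e t) a i 0 - spow (e 0) a i 0)%:E.
  apply: cvg_EFin; first by near=> n.
  by apply: cvgB; exact: spowreg_cvg.
move=> h1 h2.
have hE : (spow (e t) a i 0 - spow (e 0) a i 0)%:E = (\int[mu]_(s in `[0%R, t]%classic) (J i s)%:E)%E.
  by apply: cvg_unique h1 h2; exact: ereal_hausdorff.
by rewrite /Rintegral /= -/(J i) -hE /= addrC subrK.
Unshelve. all: by end_near.
Qed.

End SpowIntegral.

(** * Continuity of the power field at the origin *)

Section SpowContinuity.
Context {R : realType}.
Implicit Types (x : 'cV[R]_3) (a : R).

(** From |x_i| <= (x.x)^(1/2). For a > -1/2 the exponent on the right is positive, which gives
    continuity at the origin. *)
Lemma spow_le a x i : `|spow x a i 0| <= dotv x x `^ (a + 2^-1).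
Proof.
have [->|x0] := eqVneq x 0; first by rewrite spowE mxE mulr0 normr0 powR_ge0.
have r0 := dotvv_gt0 _ x0.
rewrite spowE powRD ?(gt_eqF r0) ?implybT // normrM ger0_norm ?powR_ge0 //.
rewrite ler_pM2l ?powR_gt0 // powR12_sqrt ?dotvv_ge0 // -sqrtr_sqr.
by rewrite ler_sqrt ?dotvv_ge0 // sqr_le_dotvv.
Qed.

Lemma spow_small a : - 2^-1 < a -> forall e, 0 < e ->
  exists2 d, 0 < d & forall x i, dotv x x < d -> `|spow x a i 0| < e.
Proof.
move=> a1 e e0; have q0 : 0 < a + 2^-1 by lra.
exists (e `^ (a + 2^-1)^-1); first exact: powR_gt0.
move=> x i xd; apply: le_lt_trans (spow_le a x i) _.
have := gt0_ltr_powR q0 _ _ xd; rewrite !nnegrE dotvv_ge0 powR_ge0 => /(_ isT isT).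
by rewrite -powRrM mulVf ?gt_eqF // powRr1 // ltW.
Qed.

Lemma continuous_at_spow (T : topologicalType) (e : T -> 'cV[R]_3) a (t : T) i :
  - 2^-1 < a -> (forall i, {for t, continuous (fun s => e s i 0)}) ->
  {for t, continuous (fun s => spow (e s) a i 0)}.
Proof.
move=> a1 ec; have rc := continuous_at_dotv _ _ _ _ ec ec.
have [et0|et0] := eqVneq (e t) 0.
  apply/cvgrPdist_lt => eps eps0; rewrite et0 spowE mxE mulr0.
  have [d d0 dP] := spow_small a a1 eps eps0.
  move/cvgrPdist_lt : rc => /(_ d d0); apply: filterS => s.
  rewrite et0 dotv00 sub0r normrN ger0_norm ?dotvv_ge0 // => /dP.
  by rewrite sub0r normrN.
rewrite (_ : (fun s => _) = (fun s => dotv (e s) (e s) `^ a * e s i 0)); last first.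
  by apply/funext => s; rewrite spowE.
apply: cvgM; last exact: ec.
apply: (@continuous_comp _ _ _ (fun s => dotv (e s) (e s)) (fun y => y `^ a)) => //.
by apply: continuous_powR; exact: dotvv_gt0.
Qed.

End SpowContinuity.

(** * Extreme eigenvalues and quadratic forms *)

Section QuadraticForms.
Context {R : realType}.

Lemma eigenvalue_diag2 (M : 'M[R]_2) i :
  (forall j, j != i -> M i j = 0) -> eigenvalue M (M i i).
Proof.
move=> Mi; apply/eigenvalueP; exists (delta_mx 0 i); last first.
  by apply/eqP => /rowP /(_ i); rewrite !mxE !eqxx => /eqP; rewrite oner_eq0.
rewrite -rowE; apply/rowP => j; rewrite !mxE eqxx /=.
by have [->|/Mi ->] := eqVneq j i; rewrite ?mulr1 ?mulr0.
Qed.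

Lemma mx2_ord (i : 'I_2) : i = 0 \/ i = 1.
Proof. by case: i => [[|[|//]] h]; [left|right]; exact/val_inj. Qed.

(** A root [l] of the characteristic polynomial has the left eigenvector (M 0 1, l - M 0 0), nonzero
    because M 0 1 is. *)
Lemma eigenvalue_root2 (M : 'M[R]_2) (l : R) : M 1 0 = M 0 1 -> M 0 1 != 0 ->
  (M 0 0 - l) * (M 1 1 - l) = M 0 1 ^+ 2 -> eigenvalue M l.
Proof.
move=> sM b0 E; apply/eigenvalueP.
exists (\row_j (if j == 0 then M 0 1 else l - M 0 0)).
  apply/rowP => j; rewrite !mxE !big_ord_recl big_ord0 !mxE /= addr0.
  have -> : lift ord0 ord0 = 1 :> 'I_2 by exact/val_inj.
  have -> : ord0 = 0 :> 'I_2 by exact/val_inj.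
  case: (mx2_ord j) => -> /=; first by rewrite sM; ring.
  move: E; lra.
by apply/eqP => /rowP /(_ 0); rewrite !mxE /= => /eqP; rewrite (negbTE b0).
Qed.

(** Off the diagonal case, the smaller root [l0] of the characteristic polynomial is explicit, hence
    an eigenvalue, hence at least [l]. M - l0 has determinant zero and a positive corner, so its
    form is a square up to a positive factor. *)
Lemma lmin_qform2 (M : 'M[R]_2) (l x y : R) : M 1 0 = M 0 1 -> is_lmin M l ->
  l * (x ^+ 2 + y ^+ 2) <= M 0 0 * x ^+ 2 + 2 * M 0 1 * x * y + M 1 1 * y ^+ 2.
Proof.
move=> sM [_ lm].
have x2 := sqr_ge0 x; have y2 := sqr_ge0 y.
have [b0|b0] := eqVneq (M 0 1) 0.
  have h0 : l <= M 0 0.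
    apply: lm; apply: eigenvalue_diag2 => j; by case: (mx2_ord j) => ->.
  have h1 : l <= M 1 1.
    apply: lm; apply: eigenvalue_diag2 => j; case: (mx2_ord j) => -> //.
    by rewrite sM.
  have := ler_wpM2r x2 h0; have := ler_wpM2r y2 h1; rewrite b0; lra.
pose D := (M 0 0 - M 1 1) ^+ 2 + 4 * M 0 1 ^+ 2.
have b2 : 0 < M 0 1 ^+ 2 by rewrite exprn_even_gt0.
have D0 : 0 < D by rewrite /D ltr_wpDl ?sqr_ge0 // mulr_gt0.
pose s := Num.sqrt D.
have s2 : s ^+ 2 = D by rewrite sqr_sqrtr // ltW.
have s0 : 0 < s by rewrite sqrtr_gt0.
pose l0 := (M 0 0 + M 1 1 - s) / 2.
have E : (M 0 0 - l0) * (M 1 1 - l0) = M 0 1 ^+ 2.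
  have -> : (M 0 0 - l0) * (M 1 1 - l0) = (s ^+ 2 - (M 0 0 - M 1 1) ^+ 2) / 4.
    by rewrite /l0; field.
  by rewrite s2 /D; field.
have ll0 : l <= l0 by apply: lm; exact: eigenvalue_root2.
have a0 : 0 < M 0 0 - l0.
  have : `|M 0 0 - M 1 1| < s.
    rewrite -(ltr_pXn2r (n := 2)) ?nnegrE ?normr_ge0 ?(ltW s0) // s2.
    by rewrite real_normK ?num_real // /D ltrDl mulr_gt0.
  by rewrite ltr_norml /l0 => /andP[h1 h2]; lra.
have F : 0 <= (M 0 0 - l0) * x ^+ 2 + 2 * M 0 1 * x * y + (M 1 1 - l0) * y ^+ 2.
  rewrite -(pmulr_rge0 _ a0).
  have -> : (M 0 0 - l0) * ((M 0 0 - l0) * x ^+ 2 + 2 * M 0 1 * x * y + (M 1 1 - l0) * y ^+ 2)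
    = ((M 0 0 - l0) * x + M 0 1 * y) ^+ 2 +
      ((M 0 0 - l0) * (M 1 1 - l0) - M 0 1 ^+ 2) * y ^+ 2 by ring.
  by rewrite E subrr mul0r addr0 sqr_ge0.
have := ler_wpM2r (addr_ge0 x2 y2) ll0; lra.
Qed.

Lemma eigenvalueN (n : nat) (M : 'M[R]_n) (l : R) : eigenvalue (- M) l = eigenvalue M (- l).
Proof.
apply/eigenvalueP/eigenvalueP => -[v vE v0]; exists v => //.
  by rewrite scaleNr -vE mulmxN opprK.
by rewrite mulmxN vE scaleNr opprK.
Qed.

Lemma lmax_qform2 (M : 'M[R]_2) (l x y : R) : M 1 0 = M 0 1 -> is_lmax M l ->
  M 0 0 * x ^+ 2 + 2 * M 0 1 * x * y + M 1 1 * y ^+ 2 <= l * (x ^+ 2 + y ^+ 2).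
Proof.
move=> sM [el lm].
have h : is_lmin (- M) (- l).
  by split; [rewrite eigenvalueN opprK|move=> l'; rewrite eigenvalueN => /lm; rewrite lerNl].
have := lmin_qform2 (- M) (- l) x y _ h; rewrite !mxE sM => /(_ erefl); lra.
Qed.

Lemma sym_posdef_eigenvalue_gt0 (n : nat) (M : 'M[R]_n) (l : R) :
  sym_posdef M -> eigenvalue M l -> 0 < l.
Proof.
move=> [_ pM] /eigenvalueP[v vE v0].
have vT0 : v^T != 0 by apply: contra v0 => /eqP/(congr1 trmx); rewrite trmxK trmx0 => ->.
have := pM _ vT0; rewrite trmxK vE -scalemxAl mxE.
have : 0 <= (v *m v^T) 0 0.
  by rewrite mxE sumr_ge0 // => i _; rewrite mxE -expr2 sqr_ge0.
rewrite le_eqVlt => /orP[/eqP <-|h]; first by rewrite mulr0 ltxx.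
by rewrite pmulr_lgt0.
Qed.

Lemma lmin_diag3 (d : 'rV[R]_3) (l : R) i : is_lmin (diag_mx d) l -> l <= d 0 i.
Proof.
move=> [_ lm]; apply: lm; apply/eigenvalueP; exists (delta_mx 0 i); last first.
  by apply/eqP => /rowP /(_ i); rewrite !mxE !eqxx => /eqP; rewrite oner_eq0.
rewrite -rowE; apply/rowP => j; rewrite !mxE eqxx /=.
by have [->|_] := eqVneq i j; rewrite ?mulr1n ?mulr1 ?mulr0n ?mulr0.
Qed.

End QuadraticForms.

(** * Symmetry and positivity of the solution of the Lyapunov equation *)

Section LyapunovEquation.
Context {R : realType}.
Variables (k1 k2 : R) (Q P : 'M[R]_2).
Hypotheses (k10 : 0 < k1) (k20 : 0 < k2) (Qpd : sym_posdef Q).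
Hypothesis PQ : (At k1 k2)^T *m P + P *m At k1 k2 = - Q.
Hypothesis Puniq : forall P' : 'M[R]_2,
  (At k1 k2)^T *m P' + P' *m At k1 k2 = - Q -> P' = P.

(** As [Q] is symmetric, transposing the equation shows that the transpose of [P] solves it too;
    uniqueness concludes. *)
Lemma lyapunov_sym : P^T = P.
Proof.
apply: Puniq; have [QT _] := Qpd.
by rewrite -[in RHS]QT -[- Q^T]linearN /= -PQ linearD /= !trmx_mul trmxK addrC.
Qed.

Lemma lyapunov_entries : [/\ P 1 0 = P 0 1, Q 1 0 = Q 0 1,
  Q 0 0 = 2 * k1 * P 0 0 + 2 * k2 * P 0 1,
  Q 0 1 = k1 * P 0 1 + k2 * P 1 1 - P 0 0 & Q 1 1 = - 2 * P 0 1].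
Proof.
have sP : P 1 0 = P 0 1 by rewrite -{1}lyapunov_sym mxE.
have sQ : Q 1 0 = Q 0 1 by have [QT _] := Qpd; rewrite -{1}QT mxE.
have E i j := congr1 (fun M : 'M[R]_2 => M i j) PQ.
have l1 : lift ord0 ord0 = 1 :> 'I_2 by exact/val_inj.
have l0 : ord0 = 0 :> 'I_2 by exact/val_inj.
have := E 0 0; have := E 0 1; have := E 1 1.
rewrite !mxE !big_ord_recl !big_ord0 !mxE /= !l1 !l0 sP => h1 h2 h3.
by split => //; lra.
Qed.

Lemma qform2_posdef_gt0 (M : 'M[R]_2) (x y : R) : sym_posdef M ->
  (x != 0) || (y != 0) -> 0 < M 0 0 * x ^+ 2 + (M 0 1 + M 1 0) * x * y + M 1 1 * y ^+ 2.
Proof.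
move=> [_ pM] xy; pose u : 'cV[R]_2 := \col_i (if i == 0 then x else y).
have u0 : u != 0.
  apply/eqP => /colP u0; move: xy; have := u0 0; have := u0 1; rewrite !mxE /= => -> ->.
  by rewrite eqxx.
have := pM u u0; rewrite mxE !big_ord_recl big_ord0 !mxE !big_ord_recl !big_ord0 !mxE /=.
have -> : lift ord0 ord0 = 1 :> 'I_2 by exact/val_inj.
have -> : ord0 = 0 :> 'I_2 by exact/val_inj.
by rewrite /=; congr (0 < _); ring.
Qed.

(* [4 k1^2 k2 det P = (q00 + k2 q11 + k1 q01)^2 + k1^2 det Q] *)
Lemma lyapunov_posdef : sym_posdef P.
Proof.
split; first exact: lyapunov_sym.
have [sP sQ q00 q01 q11] := lyapunov_entries.
have Q0 : 0 < Q 0 0.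
  have := qform2_posdef_gt0 Q 1 0 Qpd; rewrite oner_eq0 => /(_ isT).
  by rewrite expr1n expr0n /= !mulr0 !addr0 mulr1.
have Q1 : 0 < Q 1 1.
  have := qform2_posdef_gt0 Q 0 1 Qpd; rewrite oner_eq0 orbT => /(_ isT).
  by rewrite expr1n expr0n /= !mulr0 !mul0r !add0r mulr1.
(* The form of [Q] at (Q 1 1, - Q 0 1) equals Q 1 1 times the determinant. *)
have dQ : 0 < Q 0 0 * Q 1 1 - Q 0 1 ^+ 2.
  have := qform2_posdef_gt0 Q (Q 1 1) (- Q 0 1) Qpd.
  rewrite gt_eqF // => /(_ isT); rewrite sQ.
  have -> : Q 0 0 * Q 1 1 ^+ 2 + (Q 0 1 + Q 0 1) * Q 1 1 * - Q 0 1 +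
    Q 1 1 * (- Q 0 1) ^+ 2 = Q 1 1 * (Q 0 0 * Q 1 1 - Q 0 1 ^+ 2) by ring.
  by rewrite pmulr_rgt0.
have P0 : 0 < P 0 0.
  have : 0 < Q 0 0 + k2 * Q 1 1 by rewrite addr_gt0 // mulr_gt0.
  have -> : Q 0 0 + k2 * Q 1 1 = (2 * k1) * P 0 0 by rewrite q00 q11; ring.
  by rewrite pmulr_rgt0 // mulr_gt0.
have dP : 0 < P 0 0 * P 1 1 - P 0 1 ^+ 2.
  have : 0 < (Q 0 0 + k2 * Q 1 1 + k1 * Q 0 1) ^+ 2 + k1 ^+ 2 * (Q 0 0 * Q 1 1 - Q 0 1 ^+ 2).
    by rewrite ltr_wpDl ?sqr_ge0 // mulr_gt0 // exprn_gt0.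
  have -> : (Q 0 0 + k2 * Q 1 1 + k1 * Q 0 1) ^+ 2 + k1 ^+ 2 * (Q 0 0 * Q 1 1 - Q 0 1 ^+ 2)
    = (4 * k1 ^+ 2 * k2) * (P 0 0 * P 1 1 - P 0 1 ^+ 2) by rewrite q00 q01 q11; ring.
  by rewrite pmulr_rgt0 // !mulr_gt0 // exprn_gt0.
move=> u u0.
rewrite mxE !big_ord_recl big_ord0 !mxE !big_ord_recl !big_ord0 !mxE /=.
have -> : lift ord0 ord0 = 1 :> 'I_2 by exact/val_inj.
have -> : ord0 = 0 :> 'I_2 by exact/val_inj.
rewrite sP -(pmulr_rgt0 _ P0); set z := (X in 0 < X).
have -> : z = (P 0 0 * u 0 0 + P 0 1 * u 1 0) ^+ 2 +
    (P 0 0 * P 1 1 - P 0 1 ^+ 2) * u 1 0 ^+ 2 by rewrite /z; ring.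
have [u1|u1] := eqVneq (u 1 0) 0; last first.
  by rewrite ltr_wpDl ?sqr_ge0 // mulr_gt0 // exprn_even_gt0.
have u00 : u 0 0 != 0.
  apply: contra u0 => /eqP u00; apply/eqP/colP => i; rewrite mxE.
  by case: (mx2_ord i) => ->.
by rewrite u1 expr0n /= !mulr0 !addr0 exprn_even_gt0 //= mulf_neq0 // gt_eqF.
Qed.

End LyapunovEquation.

(** * Inequalities for inner products and real powers *)

Section DotvAlgebra.
Context {R : realType}.
Implicit Types (x y z : 'cV[R]_3) (k : R).

Lemma dotvC x y : dotv x y = dotv y x.
Proof. by rewrite !dotvE; ring. Qed.

Lemma dotvDl x y z : dotv (x + y) z = dotv x z + dotv y z.
Proof. by rewrite !dotvE !mxE; ring. Qed.

Lemma dotvDr x y z : dotv z (x + y) = dotv z x + dotv z y.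
Proof. by rewrite !dotvE !mxE; ring. Qed.

Lemma dotvZl k x y : dotv (k *: x) y = k * dotv x y.
Proof. by rewrite !dotvE !mxE; ring. Qed.

Lemma dotvZr k x y : dotv x (k *: y) = k * dotv x y.
Proof. by rewrite !dotvE !mxE; ring. Qed.

(** Lagrange's identity: the defect is the squared norm of the cross product. *)
Lemma dotv_sqr_le x y : dotv x y ^+ 2 <= dotv x x * dotv y y.
Proof.
rewrite -subr_ge0.
have -> : dotv x x * dotv y y - dotv x y ^+ 2 =
  (x 0 0 * y 1 0 - x 1 0 * y 0 0) ^+ 2 + (x 0 0 * y 2 0 - x 2 0 * y 0 0) ^+ 2 +
  (x 1 0 * y 2 0 - x 2 0 * y 1 0) ^+ 2 by rewrite !dotvE; ring.
by rewrite !addr_ge0 ?sqr_ge0.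
Qed.

Lemma dotv_young x y : 2 * dotv x y <= dotv x x + dotv y y.
Proof.
rewrite -subr_ge0.
have -> : dotv x x + dotv y y - 2 * dotv x y = dotv (x - y) (x - y).
  by rewrite !dotvE !mxE; ring.
exact: dotvv_ge0.
Qed.

Lemma powR_anti (a x y : R) : a <= 0 -> 0 < x -> x <= y -> y `^ a <= x `^ a.
Proof.
move=> a0 x0 xy; rewrite -[y](subrKC x); apply: powR_le_shift => //.
by rewrite subr_ge0.
Qed.

(** Each fraction z / (x + y) lies in [0, 1], so it is at most its q-th power, and the two fractions
    add up to 1. *)
Lemma powR_subadd (q x y : R) : 0 < q -> q <= 1 -> 0 <= x -> 0 <= y ->
  (x + y) `^ q <= x `^ q + y `^ q.
Proof.
move=> q0 q1 x0 y0.
move: x0; rewrite le_eqVlt => /orP[/eqP <-|x0].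
  by rewrite add0r lerDr powR_ge0.
move: y0; rewrite le_eqVlt => /orP[/eqP <-|y0].
  by rewrite addr0 lerDl powR_ge0.
have s0 : 0 < x + y by exact: addr_gt0.
have frac (z : R) : 0 < z -> z <= x + y -> z / (x + y) * (x + y) `^ q <= z `^ q.
  move=> z0 zs.
  have -> : z `^ q = (z / (x + y)) `^ q * (x + y) `^ q.
    by rewrite -powRM ?divr_ge0 ?(ltW z0) ?(ltW s0) // mulfVK // gt_eqF.
  rewrite ler_pM2r ?powR_gt0 // ger1_powR // divr_gt0 //=.
  by rewrite ler_pdivrMr // mul1r.
have h1 := frac x x0; have h2 := frac y y0.
apply: le_trans (lerD (h1 _) (h2 _)); rewrite ?lerDl ?lerDr ?(ltW x0) ?(ltW y0) //.
by rewrite -!mulrDl divff ?mul1r // gt_eqF.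
Qed.

(** The decay exponent arises here as 1 + (1 - p) / p = 1 / p. *)
Lemma dotv_satv (p : R) x : 1 < p ->
  dotv x (satv p x) = dotv x x + dotv x x `^ p^-1.
Proof.
move=> p1; rewrite dotvDr /spow dotvZr; congr (_ + _).
have p0 : p != 0 by rewrite gt_eqF //; lra.
have [->|x0] := eqVneq x 0.
  by rewrite dotv00 mulr0 powR0 // invr_eq0.
have r0 := dotvv_gt0 _ x0.
rewrite -{2}[dotv x x]powRr1 ?ltW // -powRD ?(gt_eqF r0) ?implybT //.
by congr (_ `^ _); field.
Qed.

Lemma dotv_diag_satv (p l : R) (d : 'rV[R]_3) x : 1 < p -> (forall i, l <= d 0 i) ->
  l * (dotv x x + dotv x x `^ p^-1) <= dotv x (diag_mx d *m satv p x).
Proof.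
move=> p1 ld; rewrite -dotv_satv // /satv.
have E i : (x + spow x ((1 - p) / p)) i 0 = (1 + dotv x x `^ ((1 - p) / p)) * x i 0.
  by rewrite !mxE; ring.
rewrite !dotvE !mul_diag_mx !mxE.
set c := _ `^ _; have c0 : 0 <= c := powR_ge0 _ _.
have h i : l * ((1 + c) * x i 0 ^+ 2) <= d 0 i * ((1 + c) * x i 0 ^+ 2).
  by rewrite ler_wpM2r // mulr_ge0 ?sqr_ge0 // addr_ge0.
have := h 0; have := h 1; have := h 2; lra.
Qed.

End DotvAlgebra.

(** * Differentiability of the sliding variables *)

Section SmoothSlidingVariable.
Context {R : realType}.
Local Notation mu := (@lebesgue_measure R).

Lemma primitive_of_addscale (y z f h : R -> R) (k : R) :
  primitive_of y f -> primitive_of z h ->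
  primitive_of (fun s => y s + k * z s) (fun s => f s + k * h s).
Proof.
move=> yf zh t t0; have [fi ->] := yf t t0; have [hi ->] := zh t t0.
have khi := integrable_scalef _ k _ hi.
split; first exact: integrable_addf.
have mD := @measurable_itv R `[0, t]%R.
have ED := @RintegralD _ _ _ mu `[0, t]%classic f (fun s => k * h s) mD fi khi.
have EZ := @RintegralZl _ _ _ mu `[0, t]%classic h k mD hi.
by rewrite ED EZ; ring.
Qed.

(* [dsatv] is unbounded near [e = 0], but [satv \o e] is its primitive across
   zeros of [e], so the singular terms cancel and the sliding variable is C^1. *)
Lemma psiv_cderive (p k : R) (e v g : R -> 'cV[R]_3) : 1 < p -> p < 2 -> k != 0 ->
  ccontinuous e -> ccontinuous v -> ccontinuous g ->
  (forall t : R, 0 < t -> is_cderive e t (v t)) ->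
  (forall i, primitive_of (fun s => v s i 0)
     (fun s => g s i 0 - k * dsatv p (e s) (v s) i 0)) ->
  forall t, 0 < t -> is_cderive (fun s => psiv p k (e s) (v s)) t (g t).
Proof.
move=> p1 p2 k0 ec vc gc ed vp t t0 i.
have p0 : p != 0 by rewrite gt_eqF //; lra.
pose a := (1 - p) / p.
have pp : 0 < p by lra.
have a1 : - 2^-1 < a by rewrite /a ltr_pdivlMr //; lra.
have a0 : a < 0 by rewrite /a ltr_pdivrMr //; lra.
have dsE s j : dsatv p (e s) (v s) j 0 = v s j 0 + dspow a (e s) (v s) j 0.
  by rewrite dsatvE // mxE.
(* The equation for [v] expresses the singular term through an integrable right-hand side and
   continuous terms. *)
have iJ (u : R) j : 0 <= u -> mu.-integrable `[0, u]%classic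
    (EFin \o (fun s => dspow a (e s) (v s) j 0)).
  move=> u0; have [hi _] := vp j u u0.
  rewrite (_ : (fun s => _) = (fun s => (k^-1 * g s j 0 - v s j 0) +
    - k^-1 * (g s j 0 - k * dsatv p (e s) (v s) j 0))); last first.
    by apply/funext => s; rewrite dsE; field.
  apply: integrable_addf; last exact: integrable_scalef.
  apply: continuous_integrable_itv => s.
  by apply: cvgB; [apply: cvgM; [exact: cvg_cst|exact: gc]|exact: vc].
have uP := spow_primitive e v a a1 a0 ec vc ed iJ i.
have dP := primitive_of_addscale _ _ _ _ k (vp i) uP.
have E : (fun s => g s i 0 - k * dsatv p (e s) (v s) i 0 + k * dspow a (e s) (v s) i 0) =
    (fun s => g s i 0 - k * v s i 0).
  by apply/funext => s; rewrite dsE; ring.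
rewrite E in dP.
have cc : {for t, continuous (fun s => g s i 0 - k * v s i 0)}.
  by apply: cvgB; [exact: gc|apply: cvgM; [exact: cvg_cst|exact: vc]].
have d1 := primitive_of_derive _ _ t dP t0 cc.
have d2 := is_derive_addf _ _ _ _ _ d1 (is_derive_scalef k _ _ _ (ed t t0 i)).
rewrite subrK in d2.
rewrite (_ : (fun s => _) = (fun s => v s i 0 + k * spow (e s) a i 0 + k * e s i 0)) //.
by apply/funext => s; rewrite !mxE; ring.
Qed.

End SmoothSlidingVariable.

(** * Decay of the observer energy where psi is nonzero *)

Section ObserverDecay.
Context {R : realType}.
Variables (p k1 k2 k3 : R) (Q P : 'M[R]_2) (qmin : R).
Hypotheses (p1 : 1 < p) (p2 : p < 2) (k30 : 0 < k3).
Hypotheses (Qpd : sym_posdef Q) (Qmin : is_lmin Q qmin).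
Hypothesis PQ : [/\ P 1 0 = P 0 1, Q 1 0 = Q 0 1,
  Q 0 0 = 2 * k1 * P 0 0 + 2 * k2 * P 0 1,
  Q 0 1 = k1 * P 0 1 + k2 * P 1 1 - P 0 0 & Q 1 1 = - 2 * P 0 1].
Implicit Types (x w : 'cV[R]_3).

Local Notation c := ((1 - p) / (3 * p - 2)).
Local Notation phi x := (phi1 p k3 x).

Definition obs_energy x w : R := P 0 0 * dotv (phi x) (phi x) +
  2 * P 0 1 * dotv (phi x) w + P 1 1 * dotv w w.

Definition obs_norm x w : R := dotv (phi x) (phi x) + dotv w w.

Definition obs_field x w : 'cV[R]_3 := - k1 *: phi x + w.

Let p3 : 0 < 3 * p - 2. Proof. by have := p1; lra. Qed.
Let c0 : c < 0. Proof. by rewrite ltr_pdivrMr //; have := p1; lra. Qed.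
Let c1 : - 2^-1 < 2 * c. Proof. by rewrite mulrA ltr_pdivlMr //; have := p2; lra. Qed.

Lemma phi1E x : phi x = (k3 + dotv x x `^ c) *: x.
Proof. by rewrite /phi1 /spow scalerDl. Qed.

(** The second factor is the eigenvalue of the differential of [phi1] in the direction of x, so phi2
    x is that differential applied to phi1 x. *)
Lemma phi2E x : phi2 p k3 x =
  ((k3 + dotv x x `^ c) * (k3 + (1 + 2 * c) * dotv x x `^ c)) *: x.
Proof.
have p30 : 3 * p - 2 != 0 by rewrite gt_eqF.
rewrite /phi2 /spow !scalerA -!scalerDl; congr (_ *: _).
have -> : dotv x x `^ (2 * (1 - p) / (3 * p - 2)) = dotv x x `^ c * dotv x x `^ c.
  rewrite -powRD; first by congr (_ `^ _); field.
  by apply/implyP => /eqP h; exfalso; move: c0 h => h1 h2; lra.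
by field.
Qed.

Lemma phi1_eq0 x : phi x = 0 -> x = 0.
Proof.
rewrite phi1E => /eqP; rewrite scaler_eq0 => /orP[|/eqP //].
by rewrite gt_eqF // ltr_wpDr // powR_ge0.
Qed.

Lemma dotv_le_phi1 x : k3 ^+ 2 * dotv x x <= dotv (phi x) (phi x).
Proof.
rewrite phi1E dotvZl dotvZr mulrA ler_wpM2r ?dotvv_ge0 //.
have h := powR_ge0 (dotv x x) c.
by rewrite -expr2 lerXn2r ?nnegrE ?addr_ge0 ?(ltW k30) // lerDl.
Qed.

Lemma qmin_gt0 : 0 < qmin.
Proof. by case: Qmin => h _; exact: sym_posdef_eigenvalue_gt0 Qpd h. Qed.

(** [obs_norm] is at least (x.x)^(1 + 2c); this is raised to the negative power c / (1 + 2c) = 1/p -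
    1. *)
Lemma obs_norm_pow x w : x != 0 ->
  obs_norm x w `^ p^-1 <= dotv x x `^ c * obs_norm x w.
Proof.
move=> x0; have r0 := dotvv_gt0 _ x0; set r := dotv x x in r0 *.
have pc : 0 < 1 + 2 * c by have := c1; lra.
have rc0 := powR_gt0 c r0.
have rE : r `^ (1 + 2 * c) = r `^ c ^+ 2 * r.
  have -> : 1 + 2 * c = c + c + 1 by ring.
  by rewrite !powRD ?(gt_eqF r0) ?implybT // powRr1 ?ltW // expr2.
have Zr : r `^ (1 + 2 * c) <= obs_norm x w.
  rewrite rE /obs_norm phi1E dotvZl dotvZr -/r [(_ + _) * (_ * r)]mulrA.
  apply: ler_wpDr; first exact: dotvv_ge0.
  rewrite ler_wpM2r ?(ltW r0) // -expr2 lerXn2r ?nnegrE ?addr_ge0 ?(ltW k30) ?(ltW rc0) //.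
  by rewrite lerDr ltW.
have r1 := powR_gt0 (1 + 2 * c) r0.
have Z0 : 0 < obs_norm x w by exact: lt_le_trans Zr.
have p0 : p != 0 by rewrite gt_eqF //; have := p1; lra.
have p30 : 3 * p - 2 != 0 by rewrite gt_eqF.
have -> : p^-1 = c / (1 + 2 * c) + 1.
  have -> : 1 + 2 * c = p / (3 * p - 2) by field.
  by field; rewrite p0 p30.
rewrite powRD ?(gt_eqF Z0) ?implybT // powRr1 ?(ltW Z0) // ler_pM2r //.
have -> : r `^ c = (r `^ (1 + 2 * c)) `^ (c / (1 + 2 * c)).
  by rewrite -powRrM; congr (_ `^ _); rewrite mulrCA mulfV ?mulr1 // gt_eqF.
apply: powR_anti => //.
by rewrite ler_pdivrMr // mul0r ltW.
Qed.

(** The differential of [phi1] acts by [d] along x and by [s] across it, with d <= s as c < 0. The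
    derivative is minus the form of [Q] carrying these weights. Cauchy-Schwarz lets [d] replace [s],
    so [Q] enters only through its least eigenvalue, and d = k3 + (1 + 2c) (x.x)^c supplies the two
    decay terms. *)
Lemma obs_energy_decay x w (g df dw : 'cV[R]_3) : x != 0 -> g = obs_field x w ->
  df = k3 *: g + dspow c x g -> dw = - k2 *: phi2 p k3 x ->
  2 * P 0 0 * dotv (phi x) df + 2 * P 0 1 * (dotv df w + dotv (phi x) dw)
    + 2 * P 1 1 * dotv w dw
  <= - (k3 * qmin) * obs_norm x w - (1 + 2 * c) * qmin * obs_norm x w `^ p^-1.
Proof.
move=> x0 g_def df_def dw_def; have r0 := dotvv_gt0 _ x0.
have [sP sQ q00 q01 q11] := PQ.
have pc : 0 < 1 + 2 * c by have := c1; lra.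
have q0 := qmin_gt0.
have np := obs_norm_pow x w x0.
have cneg := c0.
set cc := (1 - p) / (3 * p - 2) in df_def pc np cneg *.
set r := dotv x x in r0 np *.
have rc0 := powR_gt0 cc r0.
set rc := r `^ cc in rc0 np *.
pose s := k3 + rc; pose d := k3 + (1 + 2 * cc) * rc.
have s0 : 0 < s by rewrite addr_gt0.
have d0 : 0 < d by rewrite addr_gt0 // mulr_gt0.
pose N := dotv x w; pose W := dotv w w.
have phE : phi x = s *: x by rewrite phi1E.
have gE : g = (- (k1 * s)) *: x + w.
  by rewrite g_def /obs_field phE scalerA mulNr.
have xg : dotv x g = - (k1 * s) * r + N by rewrite gE dotvDr dotvZr.
have dfE : df = s *: g + (2 * cc * rc * dotv x g / r) *: x.
  by apply/colP => i; rewrite df_def /dspow !mxE -/r -/rc /s; ring.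
have dwE : dw = (- (k2 * (s * d))) *: x by rewrite dw_def phi2E scalerA mulNr.
have xdf : dotv x df = d * (N - k1 * s * r).
  rewrite dfE dotvDr !dotvZr xg -/r /d /s; by field; rewrite gt_eqF.
have wg : dotv g w = - (k1 * s) * N + W by rewrite gE dotvDl dotvZl.
have wdf : dotv df w = s * (W - k1 * s * N) + 2 * cc * rc * (N - k1 * s * r) * N / r.
  rewrite dfE dotvDl !dotvZl wg xg -/N /s; by field; rewrite gt_eqF.
have nE : obs_norm x w = s ^+ 2 * r + W.
  by rewrite /obs_norm phE dotvZl dotvZr -/r expr2 mulrA.
have NW : N ^+ 2 / r <= W by rewrite ler_pdivrMr // [W * r]mulrC; exact: dotv_sqr_le.
have NWc : 2 * cc * rc * W <= 2 * cc * rc * (N ^+ 2 / r).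
  have := ler_wpM2l (ltW rc0) NW => h.
  have c20 : 2 * cc <= 0 by lra.
  by have := ler_wnM2l c20 h; rewrite !mulrA.
have Q1 : 0 < Q 1 1.
  have := qform2_posdef_gt0 Q 0 1 Qpd; rewrite oner_eq0 orbT => /(_ isT).
  by rewrite expr1n expr0n /= !mulr0 !mul0r !add0r mulr1.
(* The Lyapunov equation, in the form of [q00], [q01] and [q11], turns coefficients of [P] into
   those of [Q]. *)
have LHS : 2 * P 0 0 * dotv (phi x) df + 2 * P 0 1 * (dotv df w + dotv (phi x) dw)
    + 2 * P 1 1 * dotv w dw =
    - (d * (Q 0 0 * s ^+ 2 * r + 2 * Q 0 1 * s * N)
       + Q 1 1 * (s * W + 2 * cc * rc * (N ^+ 2 / r))).
  rewrite phE dwE !dotvZl !dotvZr [dotv w x]dotvC -/N -/r xdf wdf q00 q01 q11 /d /s.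
  by field; rewrite gt_eqF.
have qf : qmin * (s ^+ 2 * r + W) <= Q 0 0 * s ^+ 2 * r + 2 * Q 0 1 * s * N + Q 1 1 * W.
  have h i := lmin_qform2 Q qmin (s * x i 0) (w i 0) sQ Qmin.
  have := h 0; have := h 1; have := h 2.
  have -> : W = w 0 0 ^+ 2 + w 1 0 ^+ 2 + w 2 0 ^+ 2 by rewrite /W dotvE; ring.
  have -> : r = x 0 0 ^+ 2 + x 1 0 ^+ 2 + x 2 0 ^+ 2 by rewrite /r dotvE; ring.
  have -> : N = x 0 0 * w 0 0 + x 1 0 * w 1 0 + x 2 0 * w 2 0 by rewrite /N dotvE.
  lra.
have F1 : Q 1 1 * (d * W) <= Q 1 1 * (s * W + 2 * cc * rc * (N ^+ 2 / r)).
  rewrite ler_pM2l //; have -> : d * W = s * W + 2 * cc * rc * W by rewrite /d /s; ring.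
  by rewrite lerD2l.
have F2 := ler_wpM2l (ltW d0) qf.
rewrite LHS; rewrite nE in np *.
have F3 : (1 + 2 * cc) * qmin * (s ^+ 2 * r + W) `^ p^-1 <=
  (1 + 2 * cc) * qmin * (rc * (s ^+ 2 * r + W)).
  by rewrite ler_pM2l // mulr_gt0.
have F4 : d * (qmin * (s ^+ 2 * r + W)) = k3 * qmin * (s ^+ 2 * r + W) +
  (1 + 2 * cc) * qmin * (rc * (s ^+ 2 * r + W)) by rewrite /d; ring.
lra.
Qed.

Lemma is_derive_obs_energy (psi w : R -> 'cV[R]_3) t : psi t != 0 ->
  is_cderive psi t (obs_field (psi t) (w t)) ->
  is_cderive w t (- k2 *: phi2 p k3 (psi t)) ->
  exists2 l, is_derive t (1 : R) (fun s => obs_energy (psi s) (w s)) l &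
    l <= - (k3 * qmin) * obs_norm (psi t) (w t)
         - (1 + 2 * c) * qmin * obs_norm (psi t) (w t) `^ p^-1.
Proof.
move=> x0 dpsi dw.
have df : is_cderive (fun s => phi (psi s)) t
    (k3 *: obs_field (psi t) (w t) + dspow c (psi t) (obs_field (psi t) (w t))).
  move=> i; have h1 := is_derive_scalef k3 _ _ _ (dpsi i).
  have h2 := is_cderive_spow _ _ _ c dpsi x0 i.
  have := is_derive_addf _ _ _ _ _ h1 h2.
  rewrite (_ : (fun s => phi (psi s) i 0) =
    (fun s => k3 * psi s i 0 + spow (psi s) c i 0)); last by apply/funext => s; rewrite !mxE.
  by move=> h; apply: is_derive_eq h _; rewrite !mxE.
have H := is_derive_addf _ _ _ _ _ (is_derive_addf _ _ _ _ _
   (is_derive_scalef (P 0 0) _ _ _ (is_derive_dotvv _ _ _ df))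
   (is_derive_scalef (2 * P 0 1) _ _ _ (is_derive_dotv _ _ _ _ _ df dw)))
   (is_derive_scalef (P 1 1) _ _ _ (is_derive_dotvv _ _ _ dw)).
eexists; first exact: H.
apply: le_trans (obs_energy_decay _ (w t) _ _ _ x0 erefl erefl erefl).
by rewrite /=; lra.
Qed.

End ObserverDecay.

(** * Continuity of the nonsingular terms of the vector field *)

Section FieldContinuity.
Context {R : realType} {T : topologicalType}.
Variables (p : R) (t : T).
Hypotheses (p1 : 1 < p) (p2 : p < 2).
Implicit Types (e v : T -> 'cV[R]_3).

Local Notation cont_at e := (forall i, {for t, continuous (fun s => e s i 0)}).

Lemma continuous_at_addf (f g : T -> R) : {for t, continuous f} ->
  {for t, continuous g} -> {for t, continuous (fun s => f s + g s)}.
Proof. by move=> fc gc; apply: cvgD; [exact: fc|exact: gc]. Qed.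

Lemma continuous_at_scalef (k : R) (f : T -> R) : {for t, continuous f} ->
  {for t, continuous (fun s => k * f s)}.
Proof. by move=> fc; apply: cvgM; [exact: cvg_cst|exact: fc]. Qed.

Lemma cont_at_addv e v : cont_at e -> cont_at v -> cont_at (fun s => e s + v s).
Proof.
move=> ec vc i; rewrite (_ : (fun s => _) = (fun s => e s i 0 + v s i 0)); last first.
  by apply/funext => s; rewrite mxE.
by apply: cvgD; [exact: ec|exact: vc].
Qed.

Lemma cont_at_scalev (k : R) e : cont_at e -> cont_at (fun s => k *: e s).
Proof.
move=> ec i; rewrite (_ : (fun s => _) = (fun s => k * e s i 0)); last first.
  by apply/funext => s; rewrite mxE.
by apply: cvgM; [exact: cvg_cst|exact: ec].
Qed.

Lemma cont_at_diagv (d : 'rV[R]_3) e : cont_at e -> cont_at (fun s => diag_mx d *m e s).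
Proof.
move=> ec i; rewrite (_ : (fun s => _) = (fun s => d 0 i * e s i 0)); last first.
  by apply/funext => s; rewrite mul_diag_mx mxE.
by apply: cvgM; [exact: cvg_cst|exact: ec].
Qed.

Lemma cont_at_satv e : cont_at e -> cont_at (fun s => satv p (e s)).
Proof.
move=> ec; apply: cont_at_addv => // i; apply: continuous_at_spow => //.
by rewrite ltr_pdivlMr; have := p1; have := p2; lra.
Qed.

Lemma cont_at_psiv (k : R) e v : cont_at e -> cont_at v ->
  cont_at (fun s => psiv p k (e s) (v s)).
Proof.
by move=> ec vc; apply: cont_at_addv => //; apply: cont_at_scalev; exact: cont_at_satv.
Qed.

Lemma cont_at_phi1 (k : R) e : cont_at e -> cont_at (fun s => phi1 p k (e s)).
Proof.
move=> ec; apply: cont_at_addv; first exact: cont_at_scalev.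
move=> i; apply: continuous_at_spow => //.
by rewrite ltr_pdivlMr; have := p1; have := p2; lra.
Qed.

(** The most singular exponent, 2(1 - p) / (3p - 2), exceeds -1/2 exactly because p < 2. *)
Lemma cont_at_phi2 (k : R) e : cont_at e -> cont_at (fun s => phi2 p k (e s)).
Proof.
move=> ec; apply: cont_at_addv; first apply: cont_at_addv; apply: cont_at_scalev => //.
all: move=> i; apply: continuous_at_spow => //.
all: by rewrite ltr_pdivlMr; have := p1; have := p2; lra.
Qed.

End FieldContinuity.

(** * Control of the state by sliding variables and by the Lyapunov function *)

Section Smallness.
Context {R : realType}.

Lemma coord_small (x : 'cV[R]_3) (e : R) i : 0 < e -> dotv x x < e ^+ 2 -> `|x i 0| < e.
Proof.
move=> e0 xe; rewrite -(ltr_pXn2r (n := 2)) ?nnegrE ?normr_ge0 ?(ltW e0) //.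
by rewrite real_normK ?num_real //; apply: le_lt_trans xe; exact: sqr_le_dotvv.
Qed.

(** v is the sliding variable minus k times [satv p x], and [spow] is small with x even though its
    differential is unbounded. *)
Lemma psiv_small (p k : R) : 1 < p -> p < 2 -> 0 < k -> forall eps, 0 < eps ->
  exists2 d, 0 < d & forall x v, dotv x x < d -> dotv (psiv p k x v) (psiv p k x v) < d ->
    forall i, `|x i 0| < eps /\ `|v i 0| < eps.
Proof.
move=> p1 p2 k0 eps eps0.
have K0 : 0 < 1 + 2 * k by lra.
pose e := eps / (1 + 2 * k).
have e0 : 0 < e by rewrite divr_gt0.
have eE : eps = e + k * (e + e) by rewrite /e; field; rewrite gt_eqF.
have a1 : - 2^-1 < (1 - p) / p by rewrite ltr_pdivlMr; lra.
have [d d0 dP] := spow_small _ a1 e e0.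
exists (Num.min d (e ^+ 2)); first by rewrite lt_min d0 exprn_gt0.
move=> x v; rewrite !lt_min => /andP[xd xe] /andP[_ ye] i.
have h1 := coord_small _ _ i e0 xe; have h2 := coord_small _ _ i e0 ye.
have h3 := dP x i xd.
have ke : 0 < k * e by rewrite mulr_gt0.
split; first by apply: lt_trans h1 _; rewrite eE; lra.
have -> : v i 0 = psiv p k x v i 0 - k * (x i 0 + spow x ((1 - p) / p) i 0).
  by rewrite !mxE; ring.
apply: le_lt_trans (ler_normB _ _) _; rewrite eE; apply: ltrD => //.
rewrite normrM gtr0_norm // ltr_pM2l //.
by apply: le_lt_trans (ler_normD _ _) _; exact: ltrD.
Qed.

End Smallness.

Section LyapunovFunction.
Context {R : realType}.
Variables (p m kt3 kappat kT kTP : R) (P : 'M[R]_2) (pmin pmax lL : R) (dL : 'rV[R]_3).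
Hypotheses (p1 : 1 < p) (p2 : p < 2) (m0 : 0 < m) (k30 : 0 < kt3).
Hypotheses (kappa0 : 0 < kappat) (kT0 : 0 < kT) (kTP0 : 0 < kTP) (lL0 : 0 < lL).
Hypotheses (Ps : P 1 0 = P 0 1) (Pmin : is_lmin P pmin) (Pmax : is_lmax P pmax).
Hypotheses (pmin0 : 0 < pmin) (lLd : forall i, lL <= dL 0 i).
Implicit Types (X : 'M[R]_(3, 5)).

Definition track_psi X := psiv p kT (xc 0 X) (xc 1 X).
Definition obs_psi X := psiv p kappat (xc 2 X) (xc 3 X).
Definition obs_w X : 'cV[R]_3 := m^-1 *: xc 4 X.

Definition track_energy X : R := m / 2 * dotv (track_psi X) (track_psi X)
  + kTP / 2 * dotv (xc 0 X) (diag_mx dL *m xc 0 X) + dotv (xc 2 X) (xc 2 X).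

Definition lyap X : R := track_energy X + obs_energy p kt3 P (obs_psi X) (obs_w X).

Lemma obs_energy_ge x w : pmin * obs_norm p kt3 x w <= obs_energy p kt3 P x w.
Proof.
have h i := lmin_qform2 P pmin (phi1 p kt3 x i 0) (w i 0) Ps Pmin.
rewrite /obs_norm /obs_energy !dotvE; have := h 0; have := h 1; have := h 2; lra.
Qed.

Lemma obs_energy_le x w : obs_energy p kt3 P x w <= pmax * obs_norm p kt3 x w.
Proof.
have h i := lmax_qform2 P pmax (phi1 p kt3 x i 0) (w i 0) Ps Pmax.
rewrite /obs_norm /obs_energy !dotvE; have := h 0; have := h 1; have := h 2; lra.
Qed.

Lemma obs_norm_ge0 x w : 0 <= obs_norm p kt3 x w.
Proof. by rewrite addr_ge0 ?dotvv_ge0. Qed.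

Lemma obs_energy_ge0 x w : 0 <= obs_energy p kt3 P x w.
Proof. by apply: le_trans (obs_energy_ge x w); rewrite mulr_ge0 ?obs_norm_ge0 // ltW. Qed.

Lemma obs_energy_le0 x w : obs_energy p kt3 P x w <= 0 -> x = 0 /\ w = 0.
Proof.
move=> U0; have := le_trans (obs_energy_ge x w) U0.
rewrite pmulr_rle0 // /obs_norm => h.
have h1 := dotvv_ge0 (phi1 p kt3 x); have h2 := dotvv_ge0 w.
split; last by apply: dotvv_eq0; lra.
by apply: (phi1_eq0 p kt3 k30); apply: dotvv_eq0; lra.
Qed.

Lemma dotv_diag_ge (x : 'cV[R]_3) : lL * dotv x x <= dotv x (diag_mx dL *m x).
Proof.
rewrite !dotvE !mul_diag_mx !mxE.
have h i : lL * x i 0 ^+ 2 <= dL 0 i * x i 0 ^+ 2 by rewrite ler_wpM2r ?sqr_ge0.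
have := h 0; have := h 1; have := h 2; lra.
Qed.

Lemma dotv_diag_le (x : 'cV[R]_3) :
  dotv x (diag_mx dL *m x) <= (dL 0 0 + dL 0 1 + dL 0 2) * dotv x x.
Proof.
rewrite !dotvE !mul_diag_mx !mxE.
have d0 i : 0 <= dL 0 i := le_trans (ltW lL0) (lLd i).
have h i j : 0 <= dL 0 i * x j 0 ^+ 2 by rewrite mulr_ge0 ?sqr_ge0.
have := h 0 1; have := h 0 2; have := h 1 0; have := h 1 2; have := h 2 0; have := h 2 1.
lra.
Qed.

Lemma lyap_ge0 X : 0 <= lyap X.
Proof.
have m20 : 0 <= m / 2 by rewrite divr_ge0 ?(ltW m0).
have k20 : 0 <= kTP / 2 by rewrite divr_ge0 ?(ltW kTP0).
have d0 : 0 <= dotv (xc 0 X) (diag_mx dL *m xc 0 X).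
  by apply: le_trans (dotv_diag_ge _); rewrite mulr_ge0 ?dotvv_ge0 ?(ltW lL0).
apply: addr_ge0; last exact: obs_energy_ge0.
apply: addr_ge0; last exact: dotvv_ge0.
by apply: addr_ge0; apply: mulr_ge0 => //; exact: dotvv_ge0.
Qed.

Lemma xcE k X i : xc k X i 0 = X i (inord k).
Proof. by rewrite mxE. Qed.

Lemma obs_energy_continuous_at (T : topologicalType) (f g : T -> 'cV[R]_3) (t : T) :
  (forall i, {for t, continuous (fun s => f s i 0)}) ->
  (forall i, {for t, continuous (fun s => g s i 0)}) ->
  {for t, continuous (fun s => obs_energy p kt3 P (f s) (g s))}.
Proof.
move=> fc gc; have cf := cont_at_phi1 p t p1 p2 kt3 _ fc.
exact: (continuous_at_addf _ _ _ (continuous_at_addf _ _ _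
  (continuous_at_scalef _ _ _ (continuous_at_dotv _ _ _ _ cf cf))
  (continuous_at_scalef _ _ _ (continuous_at_dotv _ _ _ _ cf gc)))
  (continuous_at_scalef _ _ _ (continuous_at_dotv _ _ _ _ gc gc))).
Qed.

Lemma lyap_continuous_at (T : topologicalType) (f : T -> 'M[R]_(3, 5)) (t : T) :
  (forall i j, {for t, continuous (fun s => f s i j)}) ->
  {for t, continuous (fun s => lyap (f s))}.
Proof.
move=> fc.
have cx k i : {for t, continuous (fun s => xc k (f s) i 0)}.
  rewrite (_ : (fun s => _) = (fun s => f s i (inord k))); last first.
    by apply/funext => s; rewrite xcE.
  exact: fc.
have cT := cont_at_psiv p t p1 p2 kT _ _ (cx 0) (cx 1).
have co := cont_at_psiv p t p1 p2 kappat _ _ (cx 2) (cx 3).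
have cw := cont_at_scalev t m^-1 _ (cx 4).
have cd := cont_at_diagv t dL _ (cx 0).
exact: (continuous_at_addf _ _ _ (continuous_at_addf _ _ _ (continuous_at_addf _ _ _
    (continuous_at_scalef _ _ _ (continuous_at_dotv _ _ _ _ cT cT))
    (continuous_at_scalef _ _ _ (continuous_at_dotv _ _ _ _ (cx 0) cd)))
    (continuous_at_dotv _ _ _ _ (cx 2) (cx 2)))
  (obs_energy_continuous_at _ _ _ _ co cw)).
Qed.

(** Small sublevel sets of V lie in small balls. This yields both the positive definiteness of V and
    Lyapunov stability. *)
Lemma lyap_small (eps : R) : 0 < eps -> exists2 eta, 0 < eta &
  forall X, lyap X < eta -> forall i j, `|X i j| < eps.
Proof.
move=> eps0.
have [d1 d10 d1P] := psiv_small p kT p1 p2 kT0 eps eps0.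
have [d2 d20 d2P] := psiv_small p kappat p1 p2 kappa0 eps eps0.
have m20 : 0 < m / 2 by rewrite divr_gt0.
have kl0 : 0 < kTP / 2 * lL by rewrite mulr_gt0 // divr_gt0.
have e30 : 0 < pmin * kt3 ^+ 2 * d2 by apply: mulr_gt0 => //; apply: mulr_gt0 => //; exact: exprn_gt0.
have e40 : 0 < pmin * (eps / m) ^+ 2 by apply: mulr_gt0 => //; apply: exprn_gt0; exact: divr_gt0.
exists (Num.min (Num.min (m / 2 * d1) (kTP / 2 * lL * d1))
  (Num.min d2 (Num.min (pmin * kt3 ^+ 2 * d2) (pmin * (eps / m) ^+ 2)))).
  by rewrite !lt_min (mulr_gt0 m20 d10) (mulr_gt0 kl0 d10) d20 e30 e40.
move=> X; rewrite !lt_min => /andP[/andP[h1 h2] /andP[h3 /andP[h4 h5]]].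
have a1 : 0 <= m / 2 * dotv (track_psi X) (track_psi X).
  by rewrite mulr_ge0 ?dotvv_ge0 // ltW.
have a2 : kTP / 2 * lL * dotv (xc 0 X) (xc 0 X) <=
    kTP / 2 * dotv (xc 0 X) (diag_mx dL *m xc 0 X).
  by rewrite -mulrA ler_pM2l ?divr_gt0 // dotv_diag_ge.
have a3 : 0 <= kTP / 2 * lL * dotv (xc 0 X) (xc 0 X).
  by rewrite mulr_ge0 ?dotvv_ge0 // ltW.
have a4 := dotvv_ge0 (xc 2 X).
have a5 := obs_energy_ge (obs_psi X) (obs_w X).
have a6 := obs_energy_ge0 (obs_psi X) (obs_w X).
have a7 := dotv_le_phi1 p kt3 k30 (obs_psi X).
have a8 := dotvv_ge0 (obs_w X).
have a9 := dotvv_ge0 (phi1 p kt3 (obs_psi X)).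
move: h1 h2 h3 h4 h5; rewrite /lyap /track_energy => h1 h2 h3 h4 h5.
have b1 : dotv (track_psi X) (track_psi X) < d1.
  by rewrite -(ltr_pM2l m20); lra.
have b2 : dotv (xc 0 X) (xc 0 X) < d1 by rewrite -(ltr_pM2l kl0); lra.
have b3 : dotv (xc 2 X) (xc 2 X) < d2 by lra.
have b4 : dotv (obs_psi X) (obs_psi X) < d2.
  rewrite -(ltr_pM2l (mulr_gt0 pmin0 (exprn_gt0 2 k30))).
  have : pmin * kt3 ^+ 2 * dotv (obs_psi X) (obs_psi X) <=
      pmin * obs_norm p kt3 (obs_psi X) (obs_w X).
    by rewrite -mulrA ler_pM2l // /obs_norm; lra.
  lra.
have b5 : dotv (obs_w X) (obs_w X) < (eps / m) ^+ 2.
  rewrite -(ltr_pM2l pmin0).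
  have : pmin * dotv (obs_w X) (obs_w X) <= pmin * obs_norm p kt3 (obs_psi X) (obs_w X).
    by rewrite ler_pM2l // /obs_norm; lra.
  lra.
have c1 := d1P _ _ b2 b1; have c2 := d2P _ _ b3 b4.
have c3 i := coord_small _ _ i (divr_gt0 eps0 m0) b5.
move=> i j; rewrite (_ : X i j = xc j X i 0); last by rewrite xcE inord_val.
case: j => [[|[|[|[|[|//]]]]] hj] /=.
- exact: (c1 i).1.
- exact: (c1 i).2.
- exact: (c2 i).1.
- exact: (c2 i).2.
have := c3 i; rewrite mxE normrM normfV (gtr0_norm m0) mulrC.
by rewrite ltr_pM2r // invr_gt0.
Qed.

Lemma lyap0 : lyap 0 = 0.
Proof.
have x0 k : xc k (0 : 'M[R]_(3, 5)) = 0 by apply/colP => i; rewrite !mxE.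
have s0 a : spow (0 : 'cV[R]_3) a = 0 by rewrite /spow scaler0.
have z0 k : psiv p k (0 : 'cV[R]_3) 0 = 0 by rewrite /psiv /satv s0 addr0 scaler0 addr0.
rewrite /lyap /track_energy /obs_energy /track_psi /obs_psi /obs_w !x0 !z0.
have -> : phi1 p kt3 (0 : 'cV[R]_3) = 0 by rewrite /phi1 s0 scaler0 addr0.
by rewrite mulmx0 scaler0 dotv00 !mulr0 !addr0.
Qed.

End LyapunovFunction.

(** * Linear bookkeeping of the decay estimates *)

Section Arithmetic.
Context {R : realFieldType}.

(** Bare scalars make norms and their powers atoms for [lra]. A, B, D, S, E, f, w are to be the
    squared norms of psi_T, the position error, e_b, psi, e_phi, phi1(psi) and e_phi / m; a suffix q
    marks the power 1/p. *)
Lemma track_rate_arith (t1 t2 t3 t4 A Aq B Bq D Dq E S f w kD kB l kap m2 k2 : R) :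
  2 * t1 <= A + E -> 2 * t4 <= D + S -> S <= 1 / k2 * f -> E = m2 * w ->
  0 <= 1 / k2 * w -> 0 <= m2 / 2 * f ->
  kD * (l * (A + Aq)) <= kD * t2 -> kB * (l * (B + Bq)) <= kB * t3 ->
  t1 - kD * t2 - kB * t3 + 2 * (t4 - kap * (D + Dq)) <=
  - (kD * l - 1 / 2) * A - kD * l * Aq - kB * l * B - kB * l * Bq
  - (2 * kap - 1) * D - 2 * kap * Dq + (m2 / 2 + 1 / k2) * (f + w).
Proof. by move=> *; lra. Qed.

Lemma lyap_le_arith (a b A B D U N : R) : 0 <= a -> 0 <= b ->
  0 <= A -> 0 <= B -> 0 <= D -> 0 <= U -> N <= b * B ->
  a * A + N + D + U <= (1 + a + b) * (A + B + U + D).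
Proof.
move=> a0 b0 A0 B0 D0 U0 NB.
have := mulr_ge0 a0 B0; have := mulr_ge0 a0 U0; have := mulr_ge0 a0 D0.
have := mulr_ge0 b0 A0; have := mulr_ge0 b0 U0; have := mulr_ge0 b0 D0.
lra.
Qed.

Lemma lyap_rate_arith (T l A Aq B Bq D Dq U Uq V Vq Y1 Y2 Y3 Y4 Y5
    a1 a2 a3 a4 b1 b2 b3 b4 c1 c2 v1 v2 : R) :
  l <= - Y2 - Y3 ->
  T <= - a1 * A - b1 * Aq - a2 * B - b2 * Bq - a4 * D - b4 * Dq + Y1 ->
  Y1 <= Y4 -> Y5 <= Y2 -> b3 * Uq <= Y3 -> a3 * U = Y5 - Y4 ->
  c1 * A <= a1 * A -> c1 * B <= a2 * B -> c1 * U <= a3 * U -> c1 * D <= a4 * D ->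
  c2 * Aq <= b1 * Aq -> c2 * Bq <= b2 * Bq -> c2 * Uq <= b3 * Uq -> c2 * Dq <= b4 * Dq ->
  v1 * V <= c1 * (A + B + U + D) -> v2 * Vq <= c2 * (Aq + Bq + Uq + Dq) ->
  T + l <= - (v1 * V) - v2 * Vq.
Proof. by move=> *; lra. Qed.

End Arithmetic.

(** * Decay rate of the Lyapunov function in the closed loop *)

Section ClosedLoop.
Context {R : realType}.
Local Notation mu := (@lebesgue_measure R).
Variables (p m kt1 kt2 kt3 kappat kT kTD kTP : R) (Q P : 'M[R]_2).
Variables (qmin pmin pmax lL : R) (dL : 'rV[R]_3).
Hypotheses (p1 : 1 < p) (p2 : p < 2) (m0 : 0 < m).
Hypothesis k30 : 0 < kt3.
Hypotheses (kappa0 : 0 < kappat) (kT0 : 0 < kT) (kTD0 : 0 < kTD) (kTP0 : 0 < kTP).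
Hypotheses (Qpd : sym_posdef Q) (Qmin : is_lmin Q qmin).
Hypothesis PQ : [/\ P 1 0 = P 0 1, Q 1 0 = Q 0 1,
  Q 0 0 = 2 * kt1 * P 0 0 + 2 * kt2 * P 0 1,
  Q 0 1 = kt1 * P 0 1 + kt2 * P 1 1 - P 0 0 & Q 1 1 = - 2 * P 0 1].
Hypotheses (Pmin : is_lmin P pmin) (Pmax : is_lmax P pmax).
Hypotheses (pmin0 : 0 < pmin) (pmax0 : 0 < pmax).
Hypotheses (lL0 : 0 < lL) (lLd : forall i, lL <= dL 0 i).
Hypotheses (gain1 : 0 < kTD * lL - 1 / 2) (gain2 : 0 < 2 * kappat - 1).
Hypothesis gain3 :
  0 < kt3 * (qmin / pmax) - 1 / (kt3 ^+ 2 * pmin) - m ^+ 2 / (2 * pmin).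
Implicit Types (X : 'M[R]_(3, 5)).

Local Notation LT := (diag_mx dL).
Local Notation F := (closed_loop p m kt1 kt2 kt3 kappat kT kTD kTP LT).
Local Notation psiT := (track_psi p kT).
Local Notation psi := (obs_psi p kappat).
Local Notation w := (obs_w m).
Local Notation V := (lyap p m kt3 kappat kT kTP P dL).
Local Notation U X := (obs_energy p kt3 P (psi X) (w X)).
Local Notation Z X := (obs_norm p kt3 (psi X) (w X)).
Local Notation q := (p^-1).

Definition obs_rate X : R := - (kt3 * qmin) * Z X
  - (1 + 2 * ((1 - p) / (3 * p - 2))) * qmin * Z X `^ q.

(** The derivative of [track_energy] after replacing the velocity error by psi_T - kT times [satv]
    of the position error: the cross terms pairing psi_T with [LT] times the position error
    cancel. *)
Definition track_rate X : R := dotv (psiT X) (xc 4 X)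
  - kTD * dotv (psiT X) (LT *m satv p (psiT X))
  - kTP * kT * dotv (satv p (xc 0 X)) (LT *m xc 0 X)
  + 2 * dotv (xc 2 X) (xc 3 X).

Let p0 : 0 < p. Proof. by have := p1; lra. Qed.
Let q0 : 0 < q. Proof. by rewrite invr_gt0. Qed.
Let q1 : q <= 1. Proof. by rewrite invf_le1 // ltW. Qed.
Let Ps : P 1 0 = P 0 1. Proof. by case: PQ. Qed.
Let qmin0 : 0 < qmin. Proof. by case: Qmin => h _; exact: sym_posdef_eigenvalue_gt0 Qpd h. Qed.

Lemma dotv_diagC (x y : 'cV[R]_3) : dotv x (LT *m y) = dotv y (LT *m x).
Proof. by rewrite !dotvE !mul_diag_mx !mxE; ring. Qed.

(** Young's inequality twice. The term psi_T . e_phi costs 1/2 of |psi_T|^2 and m^2/2 of |w|^2; the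
    term 2 e_b . psi costs one |e_b|^2 and, by kt3 |psi| <= |phi1(psi)|, 1/kt3^2 of |phi1(psi)|^2.
    These are the constants of the gain conditions. *)
Lemma track_rate_le X : track_rate X <=
  - (kTD * lL - 1 / 2) * dotv (psiT X) (psiT X)
  - kTD * lL * dotv (psiT X) (psiT X) `^ q
  - kTP * kT * lL * dotv (xc 0 X) (xc 0 X) - kTP * kT * lL * dotv (xc 0 X) (xc 0 X) `^ q
  - (2 * kappat - 1) * dotv (xc 2 X) (xc 2 X) - 2 * kappat * dotv (xc 2 X) (xc 2 X) `^ q
  + (m ^+ 2 / 2 + 1 / kt3 ^+ 2) * Z X.
Proof.
have h1 := dotv_young (psiT X) (xc 4 X).
have h2 := dotv_diag_satv p lL dL (psiT X) p1 lLd.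
have h3 := dotv_diag_satv p lL dL (xc 0 X) p1 lLd.
have h4 := dotv_young (xc 2 X) (psi X).
have h5 := dotv_satv p (xc 2 X) p1.
have evE : xc 3 X = psi X - kappat *: satv p (xc 2 X) by rewrite /obs_psi /psiv addrK.
have h6 : dotv (xc 2 X) (xc 3 X) = dotv (xc 2 X) (psi X)
    - kappat * dotv (xc 2 X) (satv p (xc 2 X)).
  by rewrite evE -scaleNr dotvDr dotvZr mulNr.
have h7 := dotv_le_phi1 p kt3 k30 (psi X).
have k32 : 0 < kt3 ^+ 2 by rewrite exprn_gt0.
have h8 : dotv (psi X) (psi X) <= 1 / kt3 ^+ 2 * dotv (phi1 p kt3 (psi X)) (phi1 p kt3 (psi X)).
  by rewrite mulrC mul1r ler_pdivlMr // mulrC.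
have h9 : dotv (xc 4 X) (xc 4 X) = m ^+ 2 * dotv (w X) (w X).
  by rewrite /obs_w dotvZl dotvZr; field; rewrite gt_eqF.
have h10 := dotvv_ge0 (w X).
have h11 := dotvv_ge0 (phi1 p kt3 (psi X)).
have h12 : 0 <= 1 / kt3 ^+ 2 * dotv (w X) (w X) by rewrite mulr_ge0 // divr_ge0 // ltW.
have h13 : 0 <= m ^+ 2 / 2 * dotv (phi1 p kt3 (psi X)) (phi1 p kt3 (psi X)).
  by rewrite mulr_ge0 // divr_ge0 // sqr_ge0.
have h14 := ler_wpM2l (ltW kTD0) h2.
have h15 := ler_wpM2l (ltW (mulr_gt0 kTP0 kT0)) h3.
rewrite /track_rate [dotv (satv _ _) _]dotv_diagC /obs_norm h6 h5.
exact: track_rate_arith h1 h4 h8 h9 h12 h13 h14 h15.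
Qed.

(** The derivative of U enters as a number [l] because only an upper bound for it is available. [c1]
    and [c2] are the least dissipation coefficients of the four parts, and [M] compares V with their
    sum. *)
Lemma lyap_rate_le : exists l1 l2 : R, [/\ 0 < l1, 0 < l2 & forall X l,
  l <= obs_rate X -> track_rate X + l <= - l1 * V X - l2 * V X `^ q].
Proof.
(* What the observer retains after paying (m^2/2 + 1/kt3^2) |zeta|^2, with |zeta|^2 lying between U
   / pmax and U / pmin. *)
pose dZ := kt3 * (qmin / pmax) - 1 / (kt3 ^+ 2 * pmin) - m ^+ 2 / (2 * pmin).
pose cZ := (1 + 2 * ((1 - p) / (3 * p - 2))) * qmin * pmax^-1 `^ q.
have p30 : 0 < 3 * p - 2 by have := p1; lra.
have cc : 0 < 1 + 2 * ((1 - p) / (3 * p - 2)).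
  have -> : 1 + 2 * ((1 - p) / (3 * p - 2)) = p / (3 * p - 2) by field; rewrite gt_eqF.
  exact: divr_gt0.
have cZ0 : 0 < cZ by rewrite /cZ; apply: mulr_gt0; [exact: mulr_gt0|rewrite powR_gt0 // invr_gt0].
have kk0 : 0 < kTP * kT * lL by apply: mulr_gt0 => //; exact: mulr_gt0.
have kd0 : 0 < kTD * lL by exact: mulr_gt0.
have k20' : 0 < 2 * kappat by rewrite mulr_gt0.
pose c1 := Num.min (Num.min (kTD * lL - 1 / 2) (kTP * kT * lL)) (Num.min dZ (2 * kappat - 1)).
pose c2 := Num.min (Num.min (kTD * lL) (kTP * kT * lL)) (Num.min cZ (2 * kappat)).
have c10 : 0 < c1 by rewrite /c1 !lt_min gain1 kk0 gain2 gain3.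
have c20 : 0 < c2 by rewrite /c2 !lt_min kd0 kk0 cZ0 k20'.
have [c1a c1b c1c c1d] : [/\ c1 <= kTD * lL - 1 / 2, c1 <= kTP * kT * lL, c1 <= dZ & c1 <= 2 * kappat - 1].
  by split; rewrite /c1 !ge_min lexx ?orbT.
have [c2a c2b c2c c2d] : [/\ c2 <= kTD * lL, c2 <= kTP * kT * lL, c2 <= cZ & c2 <= 2 * kappat].
  by split; rewrite /c2 !ge_min lexx ?orbT.
pose M := 1 + m / 2 + kTP / 2 * (dL 0 0 + dL 0 1 + dL 0 2).
have dL0 i : 0 < dL 0 i := lt_le_trans lL0 (lLd i).
have M2 : 0 < kTP / 2 * (dL 0 0 + dL 0 1 + dL 0 2).
  by apply: mulr_gt0; [exact: divr_gt0|apply: addr_gt0; [exact: addr_gt0|]].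
have m20 : 0 < m / 2 by exact: divr_gt0.
have M0 : 0 < M by rewrite /M; lra.
have Mq0 := powR_gt0 q M0.
exists (c1 / M), (c2 / M `^ q); split; [exact: divr_gt0|exact: divr_gt0|].
move=> X l ll.
have hT := track_rate_le X.
set A := dotv (psiT X) (psiT X) in hT *.
set B := dotv (xc 0 X) (xc 0 X) in hT *.
set D := dotv (xc 2 X) (xc 2 X) in hT *.
have A0 : 0 <= A := dotvv_ge0 _.
have B0 : 0 <= B := dotvv_ge0 _.
have D0 : 0 <= D := dotvv_ge0 _.
have U0 : 0 <= U X by exact: (obs_energy_ge0 _ _ _ _ Ps Pmin).
have Z0 : 0 <= Z X by exact: obs_norm_ge0.
have UZ : pmin * Z X <= U X by exact: (obs_energy_ge _ _ _ _ Ps Pmin).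
have ZU : U X <= pmax * Z X by exact: (obs_energy_le _ _ _ _ Ps Pmax).
have Aq := powR_ge0 A q; have Bq := powR_ge0 B q.
have Dq := powR_ge0 D q; have Uq := powR_ge0 (U X) q.
have ZU' : U X / pmax <= Z X by rewrite ler_pdivrMr // mulrC.
have UZ' : Z X <= U X / pmin by rewrite ler_pdivlMr // mulrC.
have Zq : pmax^-1 `^ q * U X `^ q <= Z X `^ q.
  rewrite -powRM ?invr_ge0 ?(ltW pmax0) // [pmax^-1 * _]mulrC.
  by rewrite ge0_ler_powR ?nnegrE ?(ltW q0) // divr_ge0 // ltW.
have VM : V X <= M * (A + B + U X + D).
  have hd := dotv_diag_le lL dL lL0 lLd (xc 0 X).
  have hd' := ler_wpM2l (ltW (divr_gt0 kTP0 (ltr0n R 2))) hd.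
  rewrite -/B [X in _ <= X]mulrA in hd'; rewrite /lyap /track_energy -/A -/D /M.
  exact: lyap_le_arith (ltW m20) (ltW M2) A0 B0 D0 U0 hd'.
have V0 : 0 <= V X by exact: (lyap_ge0 _ _ _ _ _ _ _ pmin lL).
have VqM : V X `^ q <= M `^ q * (A `^ q + B `^ q + U X `^ q + D `^ q).
  have AB0 : 0 <= A + B by exact: addr_ge0.
  have ABU0 : 0 <= A + B + U X by exact: addr_ge0.
  have S0 : 0 <= A + B + U X + D by exact: addr_ge0.
  apply: le_trans (_ : (M * (A + B + U X + D)) `^ q <= _).
    by rewrite ge0_ler_powR ?nnegrE ?(ltW q0) // mulr_ge0 // ltW.
  rewrite powRM ?(ltW M0) // ler_pM2l //.
  apply: le_trans (powR_subadd _ _ _ q0 q1 ABU0 D0) _.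
  rewrite lerD2r; apply: le_trans (powR_subadd _ _ _ q0 q1 AB0 U0) _.
  by rewrite lerD2r; apply: powR_subadd.
have g1 : c1 / M * V X <= c1 * (A + B + U X + D).
  by rewrite -mulrA ler_pM2l // mulrC ler_pdivrMr // mulrC.
have g2 : c2 / M `^ q * V X `^ q <= c2 * (A `^ q + B `^ q + U X `^ q + D `^ q).
  by rewrite -mulrA ler_pM2l // mulrC ler_pdivrMr // mulrC.
have e1 := ler_wpM2r A0 c1a; have e2 := ler_wpM2r B0 c1b; have e3 := ler_wpM2r U0 c1c.
have e4 := ler_wpM2r D0 c1d.
have f1 := ler_wpM2r Aq c2a; have f2 := ler_wpM2r Bq c2b; have f3 := ler_wpM2r Uq c2c.
have f4 := ler_wpM2r Dq c2d.
have n1 : (m ^+ 2 / 2 + 1 / kt3 ^+ 2) * Z X <= (m ^+ 2 / 2 + 1 / kt3 ^+ 2) * (U X / pmin).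
  rewrite ler_wpM2l // addr_ge0 // divr_ge0 // ?sqr_ge0 //.
have n2 : kt3 * qmin * (U X / pmax) <= kt3 * qmin * Z X.
  by rewrite ler_wpM2l // mulr_ge0 // ltW.
have n3 : cZ * U X `^ q <= (1 + 2 * ((1 - p) / (3 * p - 2))) * qmin * Z X `^ q.
  by rewrite /cZ -mulrA ler_pM2l // mulr_gt0.
have n4 : dZ * U X = kt3 * qmin * (U X / pmax) - (m ^+ 2 / 2 + 1 / kt3 ^+ 2) * (U X / pmin).
  by rewrite /dZ; field; rewrite !gt_eqF.
rewrite /obs_rate mulNr in ll.
rewrite !mulNr; exact: lyap_rate_arith ll hT n1 n2 n3 n4 e1 e2 e3 e4 f1 f2 f3 f4 g1 g2.
Qed.

(** * Derivatives along a solution *)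

Section Trajectory.
Variable x : R -> 'M[R]_(3, 5).
Hypotheses (xs : is_solution F x) (xcont : forall i j, continuous (fun t => x t i j)).

Lemma xc_continuous k : ccontinuous (fun s => xc k (x s)).
Proof.
move=> i t; rewrite (_ : (fun s => _) = (fun s => x s i (inord k))); last first.
  by apply/funext => s; rewrite xcE.
exact: xcont.
Qed.

Lemma psiv_comp_continuous (r k : R) (e v : R -> 'cV[R]_3) : 1 < r -> r < 2 ->
  ccontinuous e -> ccontinuous v -> ccontinuous (fun s => psiv r k (e s) (v s)).
Proof. by move=> r1 r2 ec vc i t; apply: cont_at_psiv => // j; [exact: ec|exact: vc]. Qed.

Lemma xc_primitive k i : primitive_of (fun s => xc k (x s) i 0) (fun s => xc k (F (x s)) i 0).
Proof.
rewrite (_ : (fun s => xc k (x s) i 0) = (fun s => x s i (inord k))); last first.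
  by apply/funext => s; rewrite xcE.
rewrite (_ : (fun s => xc k (F (x s)) i 0) = (fun s => F (x s) i (inord k))); last first.
  by apply/funext => s; rewrite xcE.
by move=> t t0; have := xs t t0 i (inord k).
Qed.

Lemma closed_loop_col0 X : xc 0 (F X) = xc 1 X.
Proof. by apply/colP => i; rewrite xcE mxE /= inordK. Qed.

Lemma closed_loop_col1 X : xc 1 (F X) =
  m^-1 *: track_rhs p m kT kTD kTP LT (xc 0 X) (xc 1 X) (xc 4 X).
Proof. by apply/colP => i; rewrite xcE mxE /= inordK. Qed.

Lemma closed_loop_col2 X : xc 2 (F X) = xc 3 X.
Proof. by apply/colP => i; rewrite xcE mxE /= inordK. Qed.

Lemma closed_loop_col3 X : xc 3 (F X) =
  m^-1 *: obs_rhs p m kt1 kt3 kappat (xc 2 X) (xc 3 X) (xc 4 X).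
Proof. by apply/colP => i; rewrite xcE mxE /= inordK. Qed.

Lemma closed_loop_col4 X : xc 4 (F X) = - (m * kt2) *: phi2 p kt3 (psi X).
Proof. by apply/colP => i; rewrite xcE mxE /= inordK. Qed.

Lemma bt_cderive (t : R) : 0 < t -> is_cderive (fun s => xc 0 (x s)) t (xc 1 (x t)).
Proof.
move=> t0 i; apply: (primitive_of_derive _ (fun s => xc 1 (x s) i 0)) => //.
  have := xc_primitive 0 i; congr primitive_of.
  by apply/funext => s; rewrite closed_loop_col0.
exact: xc_continuous.
Qed.

Lemma eb_cderive (t : R) : 0 < t -> is_cderive (fun s => xc 2 (x s)) t (xc 3 (x t)).
Proof.
move=> t0 i; apply: (primitive_of_derive _ (fun s => xc 3 (x s) i 0)) => //.
  have := xc_primitive 2 i; congr primitive_of.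
  by apply/funext => s; rewrite closed_loop_col2.
exact: xc_continuous.
Qed.

Lemma psiT_continuous : ccontinuous (fun s => psiT (x s)).
Proof. by apply: psiv_comp_continuous => //; exact: xc_continuous. Qed.

Lemma psi_continuous : ccontinuous (fun s => psi (x s)).
Proof. by apply: psiv_comp_continuous => //; exact: xc_continuous. Qed.

Lemma w_continuous : ccontinuous (fun s => w (x s)).
Proof.
by move=> i t; exact: (cont_at_scalev t m^-1 _ (fun j => xc_continuous 4 j t) i).
Qed.

Lemma w_cderive (t : R) : 0 < t -> is_cderive (fun s => w (x s)) t (- kt2 *: phi2 p kt3 (psi (x t))).
Proof.
move=> t0 i.
have h : is_derive t (1 : R) (fun s => xc 4 (x s) i 0) (- (m * kt2) * phi2 p kt3 (psi (x t)) i 0).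
  apply: (primitive_of_derive _ (fun s => - (m * kt2) * phi2 p kt3 (psi (x s)) i 0)) => //.
    have := xc_primitive 4 i; congr primitive_of.
    by apply/funext => s; rewrite closed_loop_col4 mxE.
  apply: continuous_at_scalef; apply: cont_at_phi2 => // j; exact: psi_continuous.
rewrite (_ : (fun s => _) = (fun s => m^-1 * xc 4 (x s) i 0)); last first.
  by apply/funext => s; rewrite mxE.
apply: is_derive_eq (is_derive_scalef _ _ _ _ h) _.
by move: (phi2 _ _ _) => y; rewrite mxE; field; rewrite gt_eqF.
Qed.

Lemma psi_cderive (t : R) : 0 < t ->
  is_cderive (fun s => psi (x s)) t (obs_field p kt1 kt3 (psi (x t)) (w (x t))).
Proof.
move=> t0; apply: (psiv_cderive _ _ _ _ (fun s => obs_field p kt1 kt3 (psi (x s)) (w (x s)))) => //.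
- by rewrite gt_eqF.
- exact: xc_continuous.
- exact: xc_continuous.
- move=> i s.
  have cf := cont_at_phi1 p s p1 p2 kt3 _ (fun j => psi_continuous j s).
  exact: (cont_at_addv s _ _ (cont_at_scalev s (- kt1) _ cf) (fun j => w_continuous j s) i).
- exact: eb_cderive.
- move=> i; have := xc_primitive 3 i; congr primitive_of; apply/funext => s.
  rewrite closed_loop_col3 /obs_rhs /obs_field -/(obs_psi _ _ _) !mxE.
  by field; rewrite gt_eqF.
Qed.

Definition track_field X : 'cV[R]_3 :=
  m^-1 *: (xc 4 X + - kTD *: (LT *m satv p (psiT X)) + - kTP *: (LT *m xc 0 X)).

Lemma psiT_cderive (t : R) : 0 < t ->
  is_cderive (fun s => psiT (x s)) t (track_field (x t)).
Proof.
move=> t0; apply: (psiv_cderive _ _ _ _ (fun s => track_field (x s))) => //.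
- by rewrite gt_eqF.
- exact: xc_continuous.
- exact: xc_continuous.
- move=> i s.
  have c1 := cont_at_diagv s dL _ (cont_at_satv p s p1 p2 _ (fun j => psiT_continuous j s)).
  have c2 := cont_at_diagv s dL _ (fun j => xc_continuous 0 j s).
  exact: (cont_at_scalev s m^-1 _ (cont_at_addv s _ _ (cont_at_addv s _ _
    (fun j => xc_continuous 4 j s) (cont_at_scalev s (- kTD) _ c1))
    (cont_at_scalev s (- kTP) _ c2)) i).
- exact: bt_cderive.
- move=> i; have := xc_primitive 1 i; congr primitive_of; apply/funext => s.
  rewrite closed_loop_col1 /track_rhs /track_field -/(track_psi _ _ _).
  move: (LT *m satv p _) (LT *m xc 0 _) (dsatv p _ _) (xc 4 _) => y1 y2 y3 y4.
  by rewrite !mxE; field; rewrite gt_eqF.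
Qed.

Lemma is_derive_track_energy (t : R) : 0 < t -> is_derive t (1 : R)
  (fun s => track_energy p m kT kTP dL (x s)) (track_rate (x t)).
Proof.
move=> t0.
have db := bt_cderive t t0; have de := eb_cderive t t0; have dp := psiT_cderive t t0.
have dLb : is_cderive (fun s => LT *m xc 0 (x s)) t (LT *m xc 1 (x t)).
  move=> i; rewrite (_ : (fun s => _) = (fun s => dL 0 i * xc 0 (x s) i 0)); last first.
    by apply/funext => s; rewrite mul_diag_mx [LHS]mxE.
  by apply: is_derive_eq (is_derive_scalef _ _ _ _ (db i)) _; rewrite mul_diag_mx [RHS]mxE.
have H := is_derive_addf _ _ _ _ _ (is_derive_addf _ _ _ _ _
  (is_derive_scalef (m / 2) _ _ _ (is_derive_dotvv _ _ _ dp))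
  (is_derive_scalef (kTP / 2) _ _ _ (is_derive_dotv _ _ _ _ _ db dLb)))
  (is_derive_dotvv _ _ _ de).
apply: is_derive_eq H _.
have vE : xc 1 (x t) = psiT (x t) - kT *: satv p (xc 0 (x t)) by rewrite /track_psi /psiv addrK.
rewrite /track_rate /track_field [dotv (xc 0 _) (LT *m xc 1 _)]dotv_diagC vE.
rewrite -scaleNr dotvDl !dotvZl !dotvZr !dotvDr !dotvZr.
by field; rewrite gt_eqF.
Qed.

(* A zero of [psi] with [w != 0] is isolated on the right since there
   [psi' = w]; after a common zero of [psi] and [w] both vanish forever. *)
Lemma obs_energy_rate (t : R) : 0 <= t -> exists2 d, 0 < d & forall s, t < s -> s < t + d ->
  exists2 l, is_derive s (1 : R) (fun u => U (x u)) l & l <= obs_rate (x s).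
Proof.
move=> t0.
have nz s : 0 < s -> psi (x s) != 0 ->
    exists2 l, is_derive s (1 : R) (fun u => U (x u)) l & l <= obs_rate (x s).
  move=> s0 ps; have h1 := psi_cderive s s0; have h2 := w_cderive s s0.
  exact: (is_derive_obs_energy p kt1 kt2 kt3 Q P qmin p1 p2 k30 Qpd Qmin PQ _ _ _ ps h1 h2).
have right_nz s : 0 <= s -> ~ (psi (x s) = 0 /\ w (x s) = 0) ->
    exists2 d, 0 < d & forall u, s < u -> u < s + d -> psi (x u) != 0.
  move=> s0 nzs.
  have [ps0|ps0] := eqVneq (psi (x s)) 0; last first.
    have [i pi] : exists i, psi (x s) i 0 != 0 by exact: colv_neq0.
    have [d d0 dP] := continuous_at_eps _ _ (psi_continuous i s) _ (etrans (normr_gt0 _) pi).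
    exists d => // u su ud; have : `|u - s| < d by rewrite gtr0_norm; lra.
    move=> /dP; apply: contraTneq => ->.
    by rewrite [(0 : 'cV[R]_3) i 0]mxE sub0r normrN ltxx.
  have ws0 : w (x s) != 0 by apply/eqP => ws; apply: nzs.
  have [i wi] : exists i, w (x s) i 0 != 0 by exact: colv_neq0.
  have fc : {for s, continuous (fun u => obs_field p kt1 kt3 (psi (x u)) (w (x u)) i 0)}.
    have cf := cont_at_phi1 p s p1 p2 kt3 _ (fun j => psi_continuous j s).
    exact: (cont_at_addv s _ _ (cont_at_scalev s (- kt1) _ cf) (fun j => w_continuous j s) i).
  have fs : obs_field p kt1 kt3 (psi (x s)) (w (x s)) i 0 != 0.
    by rewrite /obs_field ps0 phi1E scaler0 scaler0 add0r.
  have [||d d0 dP] := right_neq0 _ _ s _ (psi_continuous i s) fc _ fs.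
  - by move=> u su; apply: psi_cderive; lra.
  - by rewrite ps0 [LHS]mxE.
  exists d => // u su ud; apply: contraNneq (dP u su ud) => ->.
  by rewrite mxE.
have [[ps0 ws0]|nzt] := pselect (psi (x t) = 0 /\ w (x t) = 0); last first.
  have [d d0 dP] := right_nz t t0 nzt.
  exists d => // s ts sd; apply: nz; first lra.
  exact: dP.
have Uc s : {for s, continuous (fun u => U (x u))}.
  exact: (obs_energy_continuous_at p kt3 P p1 p2 _ _ _ s (fun j => psi_continuous j s)
    (fun j => w_continuous j s)).
have phi0 : phi1 p kt3 (0 : 'cV[R]_3) = 0 by rewrite phi1E scaler0.
have U00 : obs_energy p kt3 P 0 0 = 0.
  by rewrite /obs_energy phi0 dotv00 !mulr0 !addr0.
have rate_le0 s : obs_rate (x s) <= 0.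
  have Z0 := obs_norm_ge0 p kt3 (psi (x s)) (w (x s)).
  have p30 : 0 < 3 * p - 2 by have := p1; lra.
  have cc : 0 < 1 + 2 * ((1 - p) / (3 * p - 2)).
    have -> : 1 + 2 * ((1 - p) / (3 * p - 2)) = p / (3 * p - 2) by field; rewrite gt_eqF.
    exact: divr_gt0.
  have h1 := mulr_ge0 (ltW (mulr_gt0 k30 qmin0)) Z0.
  have h2 := mulr_ge0 (ltW (mulr_gt0 cc qmin0)) (powR_ge0 (Z (x s)) q).
  rewrite /obs_rate; lra.
(* [dini_le] asks for a bound only at times u where U is positive; there psi and w do not both
   vanish, so psi is nonzero just after u and the decay estimate applies. *)
have U0 s : t <= s -> psi (x s) = 0 /\ w (x s) = 0.
  move=> ts; apply: (obs_energy_le0 p kt3 P pmin k30 Ps Pmin pmin0).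
  rewrite -[X in _ <= X]U00 -{1}ps0 -ws0.
  apply: (dini_le (fun u => U (x u))) => // u tu us Utu e e0.
  have u0 : 0 <= u by lra.
  have nzu : ~ (psi (x u) = 0 /\ w (x u) = 0).
    by move=> [pu wu]; move: Utu; rewrite ps0 ws0 pu wu ltxx.
  have [d d0 dP] := right_nz u u0 nzu.
  have [|||d' d'0 d'P] := @dini_of_derive _ (fun v => U (x v)) (fun=> 0) u (u + d) _ _ (Uc u) _ e e0.
  - by rewrite ltrDl.
  - move=> v uv vd; have [|l dl ll] := nz v _ (dP v uv vd); first lra.
    by exists l => //; apply: le_trans ll _; exact: rate_le0.
  - exact: cvg_cst.
  exists d' => // h h0 hd; have := d'P h h0 hd.
  by rewrite ler_pdivrMr // add0r lerBlDl.
(* U is identically 0 after [t], so its derivative is 0 and so is the rate. *)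
exists 1 => // s ts _; exists 0; last first.
  have [ps ws] := U0 s (ltW ts).
  by rewrite /obs_rate /obs_norm ps ws phi0 dotv00 addr0 powR0 ?gt_eqF // !mulr0 subr0.
have dc := @is_derive_cst R R R (0 : R) s (1 : R).
apply: near_eq_is_derive dc.
near=> u; have [|-> ->] := U0 u; last by rewrite U00.
by near: u; apply: (filterS (P:=[set z | t < z]%classic)) => [z /ltW//|]; exact: lt_nbhsr.
Unshelve. all: by end_near.
Qed.

Lemma lyap_comp_continuous : continuous (fun u => V (x u)).
Proof. by move=> s; apply: lyap_continuous_at => // i j; exact: xcont. Qed.

Lemma lyap_dini (l1 l2 : R) : (forall X l, l <= obs_rate X ->
    track_rate X + l <= - l1 * V X - l2 * V X `^ q) ->
  forall t : R, 0 <= t -> forall e, 0 < e -> exists2 d, 0 < d & forall h, 0 < h -> h < d ->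
    (V (x (t + h)) - V (x t)) / h <= - l1 * V (x t) - l2 * V (x t) `^ q + e.
Proof.
move=> rl t t0 e e0.
have Vc := lyap_comp_continuous t.
have [d d0 dP] := obs_energy_rate t t0.
have td : t < t + d by rewrite ltrDl.
pose k s := - l1 * V (x s) - l2 * V (x s) `^ q.
apply: (dini_of_derive (fun u => V (x u)) k t (t + d) td _ Vc _ e e0) => [s ts sd|].
  have [l dl ll] := dP s ts sd.
  have s0 : 0 < s by exact: le_lt_trans ts.
  exists (track_rate (x s) + l); last exact: rl.
  exact: (is_derive_addf _ _ _ _ _ (is_derive_track_energy s s0) dl).
rewrite (_ : k = (fun s => - l1 * V (x s) + - l2 * V (x s) `^ q)); last first.
  by apply/funext => s; rewrite /k [- l2 * _]mulNr.
apply: continuous_at_addf; apply: continuous_at_scalef => //.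
(* Where V vanishes, continuity of V^q comes from q > 0 instead of differentiability of the
   power. *)
have [V0|V0] := eqVneq (V (x t)) 0.
  apply: eps_continuous_at => eta eta0.
  have [d1 d10 d1P] := continuous_at_eps _ _ Vc _ (powR_gt0 q^-1 eta0).
  exists d1 => // s /d1P; rewrite V0 powR0 ?gt_eqF // !subr0.
  have Vs : 0 <= V (x s) by exact: (lyap_ge0 _ _ _ _ _ _ _ pmin lL).
  rewrite ger0_norm // ger0_norm ?powR_ge0 // => h.
  have := gt0_ltr_powR q0 _ _ h; rewrite !nnegrE Vs powR_ge0 => /(_ isT isT).
  by rewrite -powRrM mulVf ?gt_eqF // powRr1 // ltW.
apply: (@continuous_comp _ _ _ (fun u => V (x u)) (fun y => y `^ q)) => //.
apply: continuous_powR; rewrite lt_neqAle eq_sym V0.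
exact: (lyap_ge0 _ _ _ _ _ _ _ pmin lL).
Qed.

End Trajectory.
End ClosedLoop.

(** * From the Dini inequality to fast finite-time stability *)

Section FiniteTimeStability.
Context {R : realType}.

(** Values at negative times are arbitrary, so a solution may be replaced by one that is constant
    there. *)
Lemma is_solution_max (G : 'M[R]_(3, 5) -> 'M[R]_(3, 5)) (x : R -> 'M[R]_(3, 5)) :
  is_solution G x -> is_solution G (fun t => x (Num.max t 0)).
Proof.
move=> xs t t0 i j; have [ix ex] := xs t t0 i j.
have mE s : 0 <= s -> Num.max s 0 = s by exact: max_l.
have E : {in `[0, t]%classic, (fun s => G (x s) i j) =1 (fun s => G (x (Num.max s 0)) i j)}.
  by move=> s; rewrite inE /= in_itv /= => /andP[s0 _]; rewrite mE.
split.
  have := @eq_integrable _ _ _ _ _ _ _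
    (fun s : measurableTypeR R => (G (x (Num.max (s : R) 0)) i j)%:E) _ ix.
  by apply; [exact: measurable_itv | move=> s /E /= ->].
rewrite mE // mE // ex; congr (_ + _).
by apply: eq_Rintegral => s /E /= ->.
Qed.

Lemma is_solution_continuous (G : 'M[R]_(3, 5) -> 'M[R]_(3, 5)) (x : R -> 'M[R]_(3, 5)) i j :
  is_solution G x -> continuous (fun t : R => x (Num.max t 0) i j).
Proof.
move=> xs; apply: (primitive_of_continuous (fun t => x t i j) (fun s => G (x s) i j)).
by move=> t t0; exact: xs.
Qed.

Lemma mx_norm_lt (X : 'M[R]_(3, 5)) (eps : R) : 0 < eps ->
  (forall i j, `|X i j| < eps) -> `|X| < eps.
Proof.
move=> eps0 Xe; change (mx_norm X < eps).
have [->//|/mx_norm_neq0[ij ->]] := eqVneq (mx_norm X) 0.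
exact: Xe.
Qed.

Variables (F : 'M[R]_(3, 5) -> 'M[R]_(3, 5)) (V : 'M[R]_(3, 5) -> R) (l1 l2 a : R).
Hypotheses (l10 : 0 < l1) (l20 : 0 < l2) (a0 : 0 < a) (a1 : a < 1).
Hypotheses (V0 : V 0 = 0) (Vge0 : forall X, 0 <= V X).
Hypothesis Vc : forall (T : topologicalType) (f : T -> 'M[R]_(3, 5)) (t : T),
  (forall i j, {for t, continuous (fun s => f s i j)}) -> {for t, continuous (fun s => V (f s))}.
Hypothesis Vsmall : forall eps : R, 0 < eps -> exists2 eta, 0 < eta &
  forall X, V X < eta -> forall i j, `|X i j| < eps.
Hypothesis Vdini : forall x, is_solution F x -> (forall i j, continuous (fun t => x t i j)) ->
  forall t : R, 0 <= t -> forall e, 0 < e -> exists2 d, 0 < d & forall h, 0 < h -> h < d ->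
    (V (x (t + h)) - V (x t)) / h <= - l1 * V (x t) - l2 * V (x t) `^ a + e.

Lemma FFTS_of_dini : FFTS F.
Proof.
have maxE s : 0 <= s -> Num.max s 0 = s by exact: max_l.
have cV : continuous V.
  move=> X; apply: (Vc _ id X) => i j; exact: coord_continuous.
(* A nonzero entry would contradict [Vsmall] taken at the size of that entry. *)
have Veq0 X : V X <= 0 -> X = 0.
  move=> VX; apply/matrixP => i j; rewrite mxE; apply/eqP; rewrite -normr_le0 leNgt.
  apply/negP => h; have [eta eta0 etaP] := Vsmall _ h.
  by have := etaP X (le_lt_trans VX eta0) i j; rewrite ltxx.
have D x : is_solution F x -> forall t : R, 0 <= t -> forall e, 0 < e ->
    exists2 d, 0 < d & forall h, 0 < h -> h < d ->
    (V (x (Num.max (t + h) 0)) - V (x (Num.max t 0))) / h <=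
      - l1 * V (x (Num.max t 0)) - l2 * V (x (Num.max t 0)) `^ a + e.
  move=> xs; apply: (Vdini (fun s => x (Num.max s 0))); first exact: is_solution_max.
  by move=> i j; exact: (is_solution_continuous F).
have vc x : is_solution F x -> continuous (fun s : R => V (x (Num.max s 0))).
  move=> xs s; apply: (Vc _ (fun u : R => x (Num.max u 0))) => i j.
  exact: (is_solution_continuous F).
split.
  move=> eps eps0; have [eta eta0 etaP] := Vsmall _ eps0.
  have /cvgrPdist_lt /(_ eta eta0) /nbhs_norm0P [delta /= delta0 dP] := cV 0.
  exists delta => // x xs x0 t t0; apply: mx_norm_lt => //; apply: etaP.
  have := dini_decay_le _ _ _ _ l10 l20 (fun s => Vge0 _) (vc x xs) (D x xs) 0 t (lexx _) t0.
  rewrite maxE // maxE // => /le_lt_trans; apply.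
  by have := dP _ x0; rewrite V0 sub0r normrN ger0_norm.
(* The estimates hold for every initial state, so the radius 1 is arbitrary. *)
exists 1, V, l1, l2, a; split; first by split.
split; first exact: cV.
split; first exact: V0.
split.
  move=> z z0; rewrite ltNge; apply/negP => /Veq0 h.
  by move: z0; rewrite h eqxx.
move=> x xs _; split.
  move=> t t0 e e0; have [d d0 dP] := D x xs t t0 e e0.
  exists d => // h h0 hd; have := dP h h0 hd.
  by rewrite !maxE // addr_ge0 // ltW.
move=> t Tt; apply: Veq0.
have t0 : 0 <= t.
  apply: le_trans Tt; rewrite /settling_bound mulr_ge0 //.
    by rewrite invr_ge0 mulr_ge0 ?(ltW l10) // subr_ge0 ltW.
  rewrite ln_ge0 // ler_pdivlMr // mul1r lerDr mulr_ge0 ?powR_ge0 //; exact: ltW.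
have := dini_decay_settling _ _ _ _ l10 l20 a1 (fun s => Vge0 _) (vc x xs) (D x xs) t.
by rewrite maxE // maxE // => /(_ Tt) ->.
Qed.

End FiniteTimeStability.

Theorem theorem4 (R : realType) (p m g : R)
  (kt1 kt2 kt3 kappat : R) (Qt Pt : 'M[R]_2) (qmin pmin pmax : R)
  (kT kTD kTP : R) (dL : 'rV[R]_3) (LT : 'M[R]_3) (lL : R) :
  1 < p -> p < 2 -> 0 < m ->
  0 < kt1 -> 0 < kt2 -> 0 < kt3 -> 0 < kappat ->
  hurwitz (At kt1 kt2) -> 1 / 2 < kappat ->
  sym_posdef Qt ->
  (At kt1 kt2)^T *m Pt + Pt *m At kt1 kt2 = - Qt ->
  (forall P' : 'M[R]_2, (At kt1 kt2)^T *m P' + P' *m At kt1 kt2 = - Qt -> P' = Pt) ->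
  is_lmin Qt qmin -> is_lmin Pt pmin -> is_lmax Pt pmax ->
  0 < kt3 * (qmin / pmax) - 1 / (kt3 ^+ 2 * pmin) ->
  0 < kT -> 0 < kTD -> 0 < kTP ->
  LT = diag_mx dL -> (forall i, 0 < dL 0 i) -> is_lmin LT lL ->
  0 < kTD * lL - 1 / 2 ->
  0 < Num.min (kt3 * (qmin / pmax) - 1 / (kt3 ^+ 2 * pmin)) (2 * kappat - 1)
      - m ^+ 2 / (2 * pmin) ->
  (* (i) closed-loop tracking error dynamics *)
  (forall (b v bd vd ad phiD phihat : R -> 'cV[R]_3) (f : R -> R)
          (Rot : R -> 'M[R]_3) (t : R),
     is_SO3 (Rot t) ->
     is_derive t (1 : R) b (v t) ->
     is_derive t (1 : R) bd (vd t) ->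
     is_derive t (1 : R) vd (ad t) ->
     f t *: (Rot t *m e3) = control p m g kT kTD kTP LT
                              (b t - bd t) (v t - vd t) (ad t) (phihat t) ->
     is_derive t (1 : R) v (m^-1 *: ((m * g) *: e3 - f t *: (Rot t *m e3) + phiD t)) ->
     is_derive t (1 : R) (fun s => b s - bd s) (v t - vd t)
     /\ is_derive t (1 : R) (fun s => v s - vd s)
          (m^-1 *: track_rhs p m kT kTD kTP LT (b t - bd t) (v t - vd t)
                                 (phiD t - phihat t)))
  /\
  (* (ii) with constant disturbance, the combined error system is FFTS *)
  FFTS (closed_loop p m kt1 kt2 kt3 kappat kT kTD kTP LT).
Proof.
move=> p1 p2 m0 k10 k20 k30 kap0 _ kap2 Qpd PQ Puniq Qmin Pmin Pmax _ kT0 kTD0 kTP0.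
move=> LTE dL0 Lmin gTD gG.
split.
  move=> b v bd vd ad phiD phihat f Rot t _ db dbd dvd fE dv; split.
    exact: is_deriveB.
  (* Inserting the commanded thrust cancels gravity and the desired acceleration and leaves phiD -
     phihat as the estimation error. *)
  have d := is_deriveB dv dvd; apply: is_derive_eq d _; rewrite fE /control /track_rhs.
  set y1 := LT *m _; set y2 := LT *m _; set y3 := dsatv _ _ _.
  move: y1 y2 y3 => y1 y2 y3.
  apply/colP => i; rewrite !mxE; field; exact: lt0r_neq0.
have Ppd := lyapunov_posdef kt1 kt2 Qt Pt k10 k20 Qpd PQ Puniq.
have PQe := lyapunov_entries kt1 kt2 Qt Pt Qpd PQ Puniq.
have pmin0 : 0 < pmin by exact: sym_posdef_eigenvalue_gt0 Ppd Pmin.1.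
have pmax0 : 0 < pmax by exact: sym_posdef_eigenvalue_gt0 Ppd Pmax.1.
have gG3 : 0 < kt3 * (qmin / pmax) - 1 / (kt3 ^+ 2 * pmin) - m ^+ 2 / (2 * pmin).
  by apply: lt_le_trans gG _; rewrite lerD2r ge_min lexx.
have gk : 0 < 2 * kappat - 1 by clear - kap2; lra.
have lL0 : 0 < lL.
  have : 0 < kTD * lL by clear - gTD; lra.
  by rewrite pmulr_rgt0.
have lLd i : lL <= dL 0 i by apply: lmin_diag3; rewrite -LTE.
have [sP _ _ _ _] := PQe.
have [l1 [l2 [l10 l20 rate]]] := lyap_rate_le p m kt1 kt2 kt3 kappat kT kTD kTP Qt Pt
  qmin pmin pmax lL dL p1 m0 k30 kap0 kT0 kTD0 kTP0 Qpd Qmin PQe Pmin Pmax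
  pmin0 pmax0 lL0 lLd gTD gk gG3.
have p0 : 0 < p by apply: lt_trans p1.
rewrite LTE; apply: (FFTS_of_dini _ (lyap p m kt3 kappat kT kTP Pt dL) l1 l2 p^-1) => //.
- by rewrite invr_gt0.
- by rewrite invf_lt1.
- exact: lyap0.
- move=> X; exact: (lyap_ge0 _ _ _ _ _ _ _ pmin lL).
- move=> T f t fc; exact: lyap_continuous_at.
- move=> eps eps0; exact: (lyap_small _ _ _ _ _ _ _ pmin lL).
- move=> x xs xc t t0 e e0.
  exact: (lyap_dini p m kt1 kt2 kt3 kappat kT kTD kTP Qt Pt qmin pmin lL dL).
Qed.
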